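(* Let $L>0$, $\ell>\tfrac12$, and let $\rho:\mathbb{C}\to\mathbb{C}$ be a real-analytic function with power series $\rho(z)=\sum_{a,b\ge 0,\ a+b\ge 2}\alpha_{a,b}z^a\bar z^b$ satisfying $\sum_{a,b\ge 0,\ a+b\ge 2}|\alpha_{a,b}|r^{a+b}<\infty$ for all $r<R$, where $0<R\le\infty$. Let $\mathcal{N}_\rho$ be the associated resonant nonlinearity (defined in the context) and let $\tau_P=\frac{L^2}{2\pi}$. Then, for all $u\in H^\ell_{\mathrm{per}}(0,L)$ with $\|u\|_{H^\ell_{\mathrm{per}}}<R$, the system $$\partial_\tau v=i\,\partial_x^2 v,\qquad \partial_\tau w=i\,\partial_x^2 w+\rho(v)$$ with initial data $(v,w)(0)=(u,0)\in H^\ell_{\mathrm{per}}(0,L)\times H^\ell_{\mathrm{per}}(0,L)$ has a unique mild solution $(v,w)\in C^0([0,\tau_P];H^\ell_{\mathrm{per}}(0,L)\times H^\ell_{\mathrm{per}}(0,L))$, and $$\mathcal{N}_\rho(u)=\tau_P^{-1}\,w(\tau_P).$$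
   Context: For $\ell>1/2$, $H^\ell_{\mathrm{per}}(0,L)$ is the Sobolev space of complex-valued periodic functions $u(x)=\sum_{K\in\mathbb{Z}}\hat u_K e^{2\pi i Kx/L}$ on $(0,L)$, with norm $\|u\|_{H^\ell_{\mathrm{per}}}=C\big(\sum_{K\in\mathbb{Z}}(1+|K|^2)^\ell|\hat u_K|^2\big)^{1/2}$, where the constant $C>0$ is fixed large enough that the norm is submultiplicative ($\|uv\|_{H^\ell_{\mathrm{per}}}\le\|u\|_{H^\ell_{\mathrm{per}}}\|v\|_{H^\ell_{\mathrm{per}}}$) and $\|u\|_{L^\infty(0,L)}\le\|u\|_{H^\ell_{\mathrm{per}}}$. The power series representation of $\rho$ is understood for $|z|<R$. Resonant nonlinearity: for $u\in H^\ell_{\mathrm{per}}(0,L)$ with $\|u\|_{H^\ell_{\mathrm{per}}}<R$, $\mathcal{N}_\rho(u)$ is defined through its Fourier coefficients $$\widehat{\mathcal{N}_\rho(u)}_K=\sum_{a,b\ge0,\ a+b\ge2}\alpha_{a,b}\Big[\sum_{(\mathbf j,\mathbf k)\in\mathcal{R}_{a,b}(K)}\prod_{m=1}^a\hat u_{\mathbf j_m}\prod_{m=1}^b\overline{\hat u_{\mathbf k_m}}\Big],\quad K\in\mathbb{Z},$$ where $$\mathcal{R}_{a,b}(K)=\Big\{(\mathbf j,\mathbf k)\in\mathbb{Z}^a\times\mathbb{Z}^b: K^2=|\mathbf j|^2-|\mathbf k|^2\ \text{and}\ K=\sum_{m=1}^a\mathbf j_m-\sum_{m=1}^b\mathbf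 k_m\Big\},$$ with $|\mathbf j|^2=\sum_m\mathbf j_m^2$; empty sums are $0$ and empty products are $1$. Schrödinger group: $S_\tau=e^{i\tau\partial_x^2}$ acts on $H^\ell_{\mathrm{per}}(0,L)$ by $S_\tau u=\sum_{K\in\mathbb{Z}}e^{-i\tau(2\pi K/L)^2}\hat u_K e^{2\pi iKx/L}$; it is $\tau_P$-periodic in $\tau$. A mild solution of the system with initial data $(u,0)$ is a pair satisfying $v(\tau)=S_\tau u$ and $w(\tau)=\int_0^\tau S_{\tau-s}\,\rho(v(s))\,ds$ for $\tau\in[0,\tau_P]$, where $\rho(v(s))$ denotes the pointwise composition and the integral is a Bochner integral in $H^\ell_{\mathrm{per}}(0,L)$. *)

(* Defs.v *)
From HB Require Import structures.
From mathcomp Require Import all_boot all_order all_algebra finmap.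
From mathcomp Require Import complex.
From mathcomp Require Import all_classical all_reals all_analysis.
From mathcomp Require Import ring.
From mathcomp Require Import ess_sup_inf.
From mathcomp.analysis Require summability.

Set Implicit Arguments.
Unset Strict Implicit.
Unset Printing Implicit Defensive.
Import Order.TTheory GRing.Theory Num.Theory.
Import numFieldNormedType.Exports.

#[export] Existing Instance summability.totally_filter.

Local Open Scope classical_set_scope.
Local Open Scope ring_scope.
Local Open Scope complex_scope.

Notation normc := ComplexField.Normc.normc.

(* Sums over countable index sets are unconditional: they are limits along the
   directed set of finite subsets.  The regular module R[i]^o carries the usual
   topology of the complex plane. *)
Definition has_csum (R : realType) (I : choiceType) (D : set I)
    (f : I -> R[i]) (s : R[i]) : Prop :=
  summability.partial_sum (patch (fun=> 0) D f : I -> R[i]^o)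
    @ summability.totally --> (s : R[i]^o).

Definition csum (R : realType) (I : choiceType) (D : set I)
    (f : I -> R[i]) : R[i] :=
  summability.sum (patch (fun=> 0) D f : I -> R[i]^o).

Definition real_analytic (R : realType) (f : R[i] -> R[i]) : Prop :=
  forall z0 : R[i], exists (c : nat * nat -> R[i]) (r : R), 0 < r /\
    forall x y : R, normc (x +i* y) < r ->
      has_csum [set: nat * nat]
        (fun ab => c ab * (x ^+ ab.1 * y ^+ ab.2)%:C) (f (z0 + (x +i* y))).

Definition expi (R : realType) (t : R) : R[i] := cos t +i* sin t.

Definition cintegrable (R : realType) (D : set R) (f : R -> R[i]) : Prop :=
  lebesgue_measure.-integrable D (EFin \o (@complex.Re R \o f)) /\
  lebesgue_measure.-integrable D (EFin \o (@complex.Im R \o f)).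

Definition cintegral (R : realType) (D : set R) (f : R -> R[i]) : R[i] :=
  (\int[lebesgue_measure]_(x in D) complex.Re (f x)) +i*
  (\int[lebesgue_measure]_(x in D) complex.Im (f x)).

Section Fourier.
Variables (R : realType) (L : R).

Definition mode (K : int) (x : R) : R[i] := expi (2 * pi * K%:~R * x / L).

Definition fcoef (u : R -> R[i]) (K : int) : R[i] :=
  L^-1%:C * cintegral `[0, L] (fun x => u x * (mode K x)^*).

Definition fseries (c : int -> R[i]) (x : R) : R[i] :=
  csum [set: int] (fun K => c K * mode K x).

Variable ell : R.

Definition sobolev_sum (c : int -> R[i]) : \bar R :=
  \esum_(K in [set: int]) ((1 + K%:~R ^+ 2) `^ ell * normc (c K) ^+ 2)%:E.

(* For ell > 1/2 the Fourier series converges absolutely, so that each class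
   modulo a.e. equality is represented by the pointwise sum of its series. *)
Definition in_Hper (u : R -> R[i]) : Prop :=
  [/\ cintegrable `[0, L] u, (sobolev_sum (fcoef u) < +oo)%E &
      forall x, has_csum [set: int] (fun K => fcoef u K * mode K x) (u x)].

End Fourier.

Lemma has_csum_lin (R : realType) (I : choiceType) (D : set I)
    (a s t : R[i]) (f g : I -> R[i]) :
  has_csum D f s -> has_csum D g t ->
  has_csum D (fun i => a * f i + g i) (a * s + t).
Proof.
move=> fs gt; rewrite /has_csum.
rewrite [X in X @ _](_ : _ =
    fun A => a *: summability.partial_sum (patch (fun=> 0) D f : I -> R[i]^o) A
       + summability.partial_sum (patch (fun=> 0) D g : I -> R[i]^o) A).
  by apply: cvgD gt; exact: cvgZl_tmp fs.
apply/funext => A; rewrite /summability.partial_sum scaler_sumr -big_split/=.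
by apply: eq_bigr => i _; rewrite /patch; case: ifP; rewrite // scaler0 addr0.
Qed.

Lemma has_csum_unique (R : realType) (I : choiceType) (D : set I)
    (f : I -> R[i]) (s t : R[i]) : has_csum D f s -> has_csum D f t -> s = t.
Proof. exact: (@norm_cvg_unique _ R[i]^o). Qed.

Lemma has_csum0 (R : realType) (I : choiceType) (D : set I) :
  has_csum D (fun=> 0 : R[i]) 0.
Proof.
rewrite /has_csum [X in X @ _](_ : _ = fun=> 0); first exact: cvg_cst.
apply/funext => A; apply: big1 => i _; rewrite /patch; by case: ifP.
Qed.

Section FourierLin.
Variables (R : realType) (L : R).
Local Notation mu := (@lebesgue_measure R).

Lemma cintegrable_lin (D : set (measurableTypeR R)) (a : R) (f g : R -> R[i]) :
  measurable D ->
  cintegrable D f -> cintegrable D g ->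
  cintegrable D (fun x => a%:C * f x + g x).
Proof.
move=> mD [f1 f2] [g1 g2]; split.
- have := integrableD mD (integrableZl mD a f1) g1.
  congr (integrable _ _ _); apply/funext => x /=.
  by case: (f x) (g x) => [p q] [p' q'] /=; rewrite mul0r subr0.
- have := integrableD mD (integrableZl mD a f2) g2.
  congr (integrable _ _ _); apply/funext => x /=.
  by case: (f x) (g x) => [p q] [p' q'] /=; rewrite mul0r addr0.
Qed.

Lemma cintegral_lin (D : set (measurableTypeR R)) (a : R) (f g : R -> R[i]) :
  measurable D ->
  cintegrable D f -> cintegrable D g ->
  cintegral D (fun x => a%:C * f x + g x) = a%:C * cintegral D f + cintegral D g.
Proof.
move=> mD [f1 f2] [g1 g2]; rewrite /cintegral.
rewrite [X in X +i* _](_ : _ = a * (\int[mu]_(x in D) complex.Re (f x)) +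
    \int[mu]_(x in D) complex.Re (g x)); last first.
  rewrite -RintegralZl// -RintegralD//; last exact: (integrableZl mD a f1).
  congr (Rintegral _ _ _); apply/funext => x /=.
  by case: (f x) (g x) => [p q] [p' q'] /=; rewrite mul0r subr0.
rewrite [X in _ +i* X](_ : _ = a * (\int[mu]_(x in D) complex.Im (f x)) +
    \int[mu]_(x in D) complex.Im (g x)); last first.
  rewrite -RintegralZl// -RintegralD//; last exact: (integrableZl mD a f2).
  congr (Rintegral _ _ _); apply/funext => x /=.
  by case: (f x) (g x) => [p q] [p' q'] /=; rewrite mul0r addr0.
by apply/eqP; rewrite eq_complex/= !mul0r subr0 addr0 !eqxx.
Qed.

Lemma continuous_linear (c : R) : continuous (fun x : R => c * x / L).
Proof.
by move=> x; apply: cvgM; [apply: cvgM; [exact: cvg_cst|exact: cvg_id]|exact: cvg_cst].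
Qed.

Lemma cintegrable_mode (D : set (measurableTypeR R)) (f : R -> R[i])
    (K : int) : measurable D ->
  cintegrable D f -> cintegrable D (fun x => f x * (mode L K x)^*).
Proof.
move=> mD [f1 f2].
have mc : measurable_fun D (fun x : R => cos (2 * pi * K%:~R * x / L)).
  apply: measurable_funTS; apply: measurable_realfun.continuous_measurable_fun => x.
  by apply: continuous_comp; [exact: continuous_linear|exact: continuous_cos].
have ms : measurable_fun D (fun x : R => sin (2 * pi * K%:~R * x / L)).
  apply: measurable_funTS; apply: measurable_realfun.continuous_measurable_fun => x.
  by apply: continuous_comp; [exact: continuous_linear|exact: continuous_sin].
have bc : [bounded cos (2 * pi * K%:~R * x / L) : R^o | x in D].
  exists 1; split => // M M1 x _ /=.
  by rewrite (le_trans _ (ltW M1))// ler_norml cos_geN1 cos_le1.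
have bs : [bounded sin (2 * pi * K%:~R * x / L) : R^o | x in D].
  exists 1; split => // M M1 x _ /=.
  by rewrite (le_trans _ (ltW M1))// ler_norml sin_geN1 sin_le1.
split.
- have := integrableD mD (integrableMl mD f1 mc bc) (integrableMl mD f2 ms bs).
  congr (integrable _ _ _); apply/funext => x /=.
  by case: (f x) => [p q] /=; rewrite mulrN opprK.
- have := integrableB mD (integrableMl mD f2 mc bc) (integrableMl mD f1 ms bs).
  congr (integrable _ _ _); apply/funext => x /=.
  by case: (f x) => [p q] /=; rewrite mulrN addrC.
Qed.

Lemma fcoef_lin (a : R) (f g : R -> R[i]) K :
  cintegrable `[0, L] f -> cintegrable `[0, L] g ->
  fcoef L (fun x => a%:C * f x + g x) K = a%:C * fcoef L f K + fcoef L g K.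
Proof.
move=> fi gi; rewrite /fcoef [in RHS]mulrCA -mulrDr; congr (_ * _).
rewrite -cintegral_lin//; last 2 first.
  exact: cintegrable_mode.
  exact: cintegrable_mode.
by congr (cintegral _ _); apply/funext => x; rewrite mulrDl mulrA.
Qed.

Lemma fcoef0 K : fcoef L (fun=> 0) K = 0.
Proof.
rewrite /fcoef (_ : (fun x => _) = fun=> 0); last first.
  by apply/funext => x; rewrite mul0r.
by rewrite /cintegral /Rintegral !integral0 mulr0.
Qed.

Lemma cintegrable0 (D : set R) : cintegrable D (fun=> 0 : R[i]).
Proof. by split; apply: integrable0. Qed.

Lemma fcoefD (f g : R -> R[i]) K :
  cintegrable `[0, L] f -> cintegrable `[0, L] g ->
  fcoef L (fun x => f x + g x) K = fcoef L f K + fcoef L g K.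
Proof.
move=> fi gi; have := fcoef_lin 1 K fi gi; rewrite rmorph1 mul1r => <-.
have -> // : (fun x => f x + g x) = (fun x => 1 * f x + g x).
by apply/funext => x; rewrite mul1r.
Qed.

Lemma fcoefZ (a : R) (f : R -> R[i]) K : cintegrable `[0, L] f ->
  fcoef L (fun x => a%:C * f x) K = a%:C * fcoef L f K.
Proof.
move=> fi; have := fcoef_lin a K fi (cintegrable0 _); rewrite fcoef0 addr0 => <-.
have -> // : (fun x => a%:C * f x) = (fun x => a%:C * f x + 0).
by apply/funext => x; rewrite addr0.
Qed.

End FourierLin.

Section SobolevSum.
Variables (R : realType) (ell : R).
Implicit Types (f g h : int -> R[i]).
Local Notation S := (sobolev_sum ell).
Import ComplexField.Normc.

Let wt (K : int) : R := (1 + K%:~R ^+ 2) `^ ell.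

Let wt_gt0 K : 0 < wt K.
Proof. by apply: powR_gt0; rewrite ltr_wpDr// sqr_ge0. Qed.

Let tm_ge0 (c : int -> R[i]) K : (0 <= (wt K * normc (c K) ^+ 2)%:E)%E.
Proof. by rewrite lee_fin mulr_ge0 ?sqr_ge0// ltW// wt_gt0. Qed.

Lemma sobolev_sum_ge0 f : (0 <= S f)%E.
Proof. by apply: esum_ge0 => K _; exact: tm_ge0. Qed.

Lemma esum_scale_le (k : R) (a : int -> \bar R) : 0 <= k ->
  (forall K, 0 <= a K)%E ->
  (\esum_(K in [set: int]) (k%:E * a K) <= k%:E * \esum_(K in [set: int]) a K)%E.
Proof.
move=> k0 a0; apply: ge_ereal_sup => _ [A [Af _] <-].
rewrite fsbig_finite//= -ge0_sume_distrr//.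
apply: lee_wpmul2l; first by rewrite lee_fin.
apply: esum_ge; exists A => //.
by rewrite fsbig_finite.
Qed.

Lemma normcD_sqr (t : R) (z w : R[i]) : 0 < t ->
  normc (z + w) ^+ 2 <= (1 + t) * normc z ^+ 2 + (1 + t^-1) * normc w ^+ 2.
Proof.
move=> t0; set p := normc z; set q := normc w.
have p0 : 0 <= p by rewrite /p; case: (z) => a b; exact: sqrtr_ge0.
have q0 : 0 <= q by rewrite /q; case: (w) => a b; exact: sqrtr_ge0.
have r0 : 0 <= normc (z + w) by case: (z + w) => a b; exact: sqrtr_ge0.
apply: (@le_trans _ _ ((p + q) ^+ 2)).
  by rewrite ler_sqr ?nnegrE ?addr_ge0//; exact: le_normcD.
rewrite -subr_ge0 (_ : _ - _ = t^-1 * (t * p - q) ^+ 2).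
  by rewrite mulr_ge0 ?sqr_ge0 ?invr_ge0 ?ltW.
by field; rewrite gt_eqF.
Qed.

Lemma sobolev_sum_add (t : R) f g h : 0 < t ->
  (forall K, h K = f K + g K) ->
  (S h <= (1 + t)%:E * S f + (1 + t^-1)%:E * S g)%E.
Proof.
move=> t0 hE.
have t1 : 0 <= 1 + t by rewrite addr_ge0// ltW.
have t2 : 0 <= 1 + t^-1 by rewrite addr_ge0// invr_ge0 ltW.
apply: le_trans (leeD (esum_scale_le t1 (tm_ge0 _)) (esum_scale_le t2 (tm_ge0 _))).
rewrite -esumD; last 2 first.
- by move=> K _; rewrite mule_ge0 ?lee_fin//; exact: tm_ge0.
- by move=> K _; rewrite mule_ge0 ?lee_fin//; exact: tm_ge0.
apply: le_esum => K _; rewrite -!EFinM -EFinD lee_fin hE.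
rewrite [leRHS](_ : _ = wt K * ((1 + t) * normc (f K) ^+ 2 +
    (1 + t^-1) * normc (g K) ^+ 2)); last first.
  by rewrite /wt mulrDr !mulrA ![(1 + _) * _]mulrC.
by rewrite ler_pM2l ?wt_gt0// normcD_sqr.
Qed.

Lemma sobolev_sumZ (a : R) f h :
  (forall K, h K = a%:C * f K) ->
  (S h <= (a ^+ 2)%:E * S f)%E.
Proof.
move=> hE.
apply: le_trans (esum_scale_le (sqr_ge0 a) (tm_ge0 _)).
apply: le_esum => K _; rewrite hE normcM exprMn -EFinM lee_fin.
rewrite [normc a%:C](_ : _ = `|a|); last first.
  by rewrite /= expr0n addr0 sqrtr_sqr.
by rewrite real_normK ?num_real// mulrCA.
Qed.

Lemma sqrt_le_sqr (x y : R) : 0 <= x -> Num.sqrt x <= y -> x <= y ^+ 2.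
Proof.
move=> x0 xy; rewrite -[leLHS]sqr_sqrtr//.
by rewrite ler_sqr ?nnegrE ?sqrtr_ge0 ?(le_trans _ xy) ?sqrtr_ge0.
Qed.

Lemma sqrtr_le_add (x a b : R) : 0 <= a -> 0 <= b ->
  (forall t, 0 < t -> x <= (1 + t) * a + (1 + t^-1) * b) ->
  Num.sqrt x <= Num.sqrt a + Num.sqrt b.
Proof.
move=> a0 b0 xab; apply/ler_addgt0Pr => e e0.
have e2 : 0 < e / 2 by rewrite divr_gt0.
have [p [pE p0 ap]] : exists p, [/\ p = Num.sqrt a + e / 2, 0 < p & a <= p ^+ 2].
  exists (Num.sqrt a + e / 2); split=> //; first by rewrite ltr_wpDl ?sqrtr_ge0.
  by apply: sqrt_le_sqr => //; rewrite lerDl ltW.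
have [q [qE q0 bq]] : exists q, [/\ q = Num.sqrt b + e / 2, 0 < q & b <= q ^+ 2].
  exists (Num.sqrt b + e / 2); split=> //; first by rewrite ltr_wpDl ?sqrtr_ge0.
  by apply: sqrt_le_sqr => //; rewrite lerDl ltW.
have -> : Num.sqrt a + Num.sqrt b + e = p + q.
  by rewrite pE qE addrACA -splitr.
have pq0 : 0 <= p + q by rewrite addr_ge0// ltW.
suff xpq : x <= (p + q) ^+ 2.
  by rewrite (le_trans (ler_wsqrtr xpq))// sqrtr_sqr ger0_norm.
apply: (le_trans (xab _ (divr_gt0 q0 p0))).
apply: (@le_trans _ _ ((1 + q / p) * p ^+ 2 + (1 + (q / p)^-1) * q ^+ 2)).
  by apply: lerD; rewrite ler_wpM2l// addr_ge0// ?invr_ge0 divr_ge0// ltW.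
rewrite le_eqVlt; apply/orP; left; apply/eqP.
by field; rewrite !gt_eqF.
Qed.

Lemma sqrtr_fine_le_add (x a b : \bar R) :
  (0 <= x)%E -> (0 <= a)%E -> (0 <= b)%E -> (a < +oo)%E -> (b < +oo)%E ->
  (forall t, 0 < t -> (x <= (1 + t)%:E * a + (1 + t^-1)%:E * b)%E) ->
  Num.sqrt (fine x) <= Num.sqrt (fine a) + Num.sqrt (fine b).
Proof.
case: a => [a||]//; case: b => [b||]//; case: x => [x||]//= x0 a0 b0 _ _ xab.
  by apply: sqrtr_le_add => // t /xab.
by have := xab 1 ltr01.
Qed.

Lemma sqrtr_fine_le_scale (l : R) (x a : \bar R) :
  (0 <= x)%E -> (0 <= a)%E -> (a < +oo)%E -> (x <= (l ^+ 2)%:E * a)%E ->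
  Num.sqrt (fine x) <= `|l| * Num.sqrt (fine a).
Proof.
case: a => [a||]//; case: x => [x||]//= x0 a0 _; rewrite lee_fin => xla.
by rewrite -sqrtr_sqr -sqrtrM ?sqr_ge0// ler_wsqrtr.
Qed.

Lemma sqrtr_fine_eq0 (x : \bar R) :
  Num.sqrt (fine x) = 0 -> (0 <= x)%E -> (x < +oo)%E -> x = 0%E.
Proof.
case: x => [x||]//= /eqP; rewrite sqrtr_eq0 => x0; rewrite lee_fin => x1 _.
by congr EFin; apply/eqP; rewrite eq_le x0.
Qed.

Lemma sobolev_sqrt_add f g h : (S f < +oo)%E -> (S g < +oo)%E ->
  (forall K, h K = f K + g K) ->
  Num.sqrt (fine (S h)) <= Num.sqrt (fine (S f)) + Num.sqrt (fine (S g)).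
Proof.
move=> foo goo hE; apply: sqrtr_fine_le_add foo goo _.
- exact: sobolev_sum_ge0.
- exact: sobolev_sum_ge0.
- exact: sobolev_sum_ge0.
- by move=> t t0; exact: sobolev_sum_add.
Qed.

Lemma sobolev_sum_eq0 f : S f = 0%E -> forall K, f K = 0.
Proof.
move=> Sf K; apply: eq0_normc; apply/eqP; rewrite -sqrf_eq0 eq_le sqr_ge0 andbT.
rewrite -(ler_pM2l (wt_gt0 K)) mulr0 -lee_fin -[leRHS]Sf.
apply: esum_ge; exists [set K]; first by split => //; exact: finite_set1.
rewrite fsbig_set1; exact: lexx.
Qed.

End SobolevSum.

(* Rcomplex R is R[i] with its structure of module over R, needed to make the
   Sobolev space a normed module over R. *)
Definition Hper_pred (R : realType) (L ell : R) : {pred R -> Rcomplex R} :=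
  mem [set u | in_Hper L ell u].

Record Hper (R : realType) (L ell : R) (C : {posnum R}) : Type := MkHper {
  Hfun : R -> Rcomplex R;
  HfunP : Hfun \in Hper_pred L ell
}.
Definition Happ (R : realType) (L ell : R) (C : {posnum R})
  (u : Hper L ell C) : R -> R[i] := Hfun u.
Coercion Happ : Hper >-> Funclass.

Section HperModule.
Variables (R : realType) (L ell : R) (C : {posnum R}).

HB.instance Definition _ := [isSub for @Hfun R L ell C].
HB.instance Definition _ := [Choice of Hper L ell C by <:].

Lemma Rcomplex_scaleE (a : R) (z : Rcomplex R) : a *: z = a%:C * z.
Proof. by case: z => p q; apply/eqP; rewrite eq_complex/= !mul0r subr0 addr0 !eqxx. Qed.

Lemma in_Hper0 : in_Hper L ell (fun=> 0).
Proof.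
split.
- exact: cintegrable0.
- rewrite /sobolev_sum esum1 ?ltry// => K _.
  by rewrite fcoef0 ComplexField.Normc.normc0 expr0n mulr0.
- move=> x; under [X in has_csum _ X]funext do rewrite fcoef0 mul0r.
  exact: has_csum0.
Qed.

Lemma in_Hper_lin (a : R) (f g : R -> R[i]) :
  in_Hper L ell f -> in_Hper L ell g ->
  in_Hper L ell (fun x => a%:C * f x + g x).
Proof.
move=> [fi fS fE] [gi gS gE].
have mD : measurable (`[0, L] : set (measurableTypeR R)) by exact: measurable_itv.
have cE K := fcoef_lin a K fi gi.
split.
- exact: cintegrable_lin.
- have := @sobolev_sum_add R ell 1 (fun K => a%:C * fcoef L f K) _ _ ltr01 cE.
  move=> /le_lt_trans; apply; apply: lte_add_pinfty; apply: lte_mul_pinfty.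
  + by rewrite lee_fin addr_ge0.
  + by [].
  + apply: (le_lt_trans (@sobolev_sumZ R ell a (fcoef L f) _ (fun=> erefl))).
    by apply: lte_mul_pinfty fS; [rewrite lee_fin sqr_ge0|].
  + by rewrite lee_fin addr_ge0 ?invr_ge0.
  + by [].
  + exact: gS.
- move=> x; under [X in has_csum _ X]funext do rewrite cE mulrDl -mulrA.
  exact: has_csum_lin.
Qed.

Lemma Hper_submod_closed : submod_closed (Hper_pred L ell).
Proof.
split; first exact: mem_set in_Hper0.
move=> a f g /set_mem fH /set_mem gH; apply: mem_set => /=.
have -> : a *: f + g = (fun x => a%:C * f x + g x : R[i]).
  by apply/funext => x; rewrite -Rcomplex_scaleE.
exact: (@in_Hper_lin a f g fH gH).
Qed.

HB.instance Definition _ := GRing.isSubmodClosed.Build _ _ (Hper_pred L ell)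
  Hper_submod_closed.
HB.instance Definition _ := [SubChoice_isSubLmodule of Hper L ell C by <:].

Definition Hnorm (u : Hper L ell C) : R :=
  C%:num * Num.sqrt (fine (sobolev_sum ell (fcoef L u))).

Lemma HappD (u v : Hper L ell C) :
  (u + v : Hper L ell C) = (fun x => u x + v x) :> (R -> R[i]).
Proof. by []. Qed.

Lemma HappZ (l : R) (u : Hper L ell C) :
  (l *: u : Hper L ell C) = (fun x => l%:C * u x) :> (R -> R[i]).
Proof. by apply/funext => x; rewrite -Rcomplex_scaleE. Qed.

Lemma HfunS (u : Hper L ell C) : in_Hper L ell u.
Proof. exact: set_mem (HfunP u). Qed.

Lemma HnormD u v : Hnorm (u + v) <= Hnorm u + Hnorm v.
Proof.
have [ui us _] := HfunS u; have [vi vs _] := HfunS v.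
rewrite /Hnorm -mulrDr ler_pM2l//; apply: sobolev_sqrt_add us vs _ => K.
by rewrite HappD fcoefD.
Qed.

Lemma HnormZ_le (l : R) u : Hnorm (l *: u) <= `|l| * Hnorm u.
Proof.
have [ui us _] := HfunS u.
rewrite /Hnorm mulrCA ler_pM2l//.
have cE K : fcoef L (l *: u : Hper L ell C) K = l%:C * fcoef L u K.
  by rewrite HappZ fcoefZ.
have := @sobolev_sumZ R ell l (fcoef L u) _ cE.
apply: sqrtr_fine_le_scale us.
- exact: sobolev_sum_ge0.
- exact: sobolev_sum_ge0.
Qed.

Lemma HnormZ (l : R) u : Hnorm (l *: u) = `|l| * Hnorm u.
Proof.
apply/eqP; rewrite eq_le HnormZ_le/=; have [->|l0] := eqVneq l 0.
  by rewrite normr0 mul0r mulr_ge0// sqrtr_ge0.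
rewrite -[u in leLHS](scalerK l0) mulrC -ler_pdivlMr ?normr_gt0// mulrC -normfV.
exact: HnormZ_le.
Qed.

Lemma Hnorm0_eq0 u : Hnorm u = 0 -> u = 0.
Proof.
have [ui us uE] := HfunS u.
move=> /eqP; rewrite mulf_eq0 gt_eqF//= => /eqP /sqrtr_fine_eq0.
move=> /(_ (sobolev_sum_ge0 _ _) us) /sobolev_sum_eq0 c0.
apply: val_inj; apply/funext => x; apply: has_csum_unique (uE x) _.
under [X in has_csum _ X]funext do rewrite c0 mul0r.
exact: has_csum0.
Qed.

HB.instance Definition _ :=
  Lmodule_isNormed.Build R (Hper L ell C) HnormD HnormZ Hnorm0_eq0.

Lemma Hper_normE (u : Hper L ell C) :
  `|u| = C%:num * Num.sqrt (fine (sobolev_sum ell (fcoef L u))).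
Proof. by []. Qed.

End HperModule.

Definition Linfty_norm (R : realType) (L : R) (u : R -> R[i]) : \bar R :=
  ess_sup lebesgue_measure
    (patch (fun=> 0%E) `]0, L[ (fun x => (normc (u x))%:E)).

(* That the product of two elements of the space is again in the space is not
   part of this condition, since it does not depend on C. *)
Definition Hconst_admissible (R : realType) (L ell : R) (C : {posnum R}) :=
  (forall u v uv : Hper L ell C,
     (forall x, uv x = u x * v x) -> `|uv| <= `|u| * `|v|) /\
  (forall u : Hper L ell C,
     (Linfty_norm L u <= `|u|%:E)%E).

Section Bochner.
Context d (T : measurableType d) (R : realType) (X : normedModType R).
Variable mu : {measure set T -> \bar R}.

Definition bochner_simple (D : set T) (s : T -> X) : Prop :=
  [/\ finite_set (range s),
      forall x, measurable (s @^-1` [set x]) &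
      forall x, x != 0 -> (mu (D `&` s @^-1` [set x]) < +oo)%E].

Definition bochner_sintegral (D : set T) (s : T -> X) : X :=
  \sum_(x \in [set: X]) fine (mu (D `&` s @^-1` [set x])) *: x.

Definition has_bochner_integral (D : set T) (f : T -> X) (I : X) : Prop :=
  exists s : nat -> T -> X,
    [/\ forall n, bochner_simple D (s n),
        {ae mu, forall t, D t -> s n t @[n --> \oo] --> f t},
        (\int[mu]_(t in D) `|f t - s n t|%:E)%E @[n --> \oo] --> 0%E &
        bochner_sintegral D (s n) @[n --> \oo] --> I].

End Bochner.

Section System.
Variables (R : realType) (L ell : R) (C : {posnum R}).
Local Notation H := (Hper L ell C).

Definition tauP : R := L ^+ 2 / (2 * pi).

Definition schrodinger (t : R) (u : R -> R[i]) : R -> R[i] :=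
  fseries L (fun K => expi (- t * (2 * pi * K%:~R / L) ^+ 2) * fcoef L u K).

Variable rho : R[i] -> R[i].

(* The integrand s |-> S_(t-s) rho(v(s)) is given pointwise; g and h are its
   two stages seen as H-valued maps, so that their existence asserts that
   rho(v(s)) and S_(t-s) rho(v(s)) belong to the Sobolev space. *)
Definition mild_solution (u : H) (v w : R -> H) : Prop :=
  [/\ {within `[0, tauP], continuous (fun t => (v t, w t))},
      forall t, 0 <= t <= tauP -> v t = schrodinger t u :> (R -> R[i]) &
      exists g : R -> H,
        (forall s, 0 <= s <= tauP -> g s = rho \o v s :> (R -> R[i])) /\
        forall t, 0 <= t <= tauP -> exists h : R -> H,
          (forall s, 0 <= s <= t ->
             h s = schrodinger (t - s) (g s) :> (R -> R[i])) /\
          has_bochner_integral lebesgue_measure `[0, t] h (w t)].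

Variable alpha : nat -> nat -> R[i].

Definition resonant_set (a b : nat) (K : int) :
    set ({ffun 'I_a -> int} * {ffun 'I_b -> int}) :=
  [set jk : {ffun 'I_a -> int} * {ffun 'I_b -> int} |
    K ^+ 2 = \sum_m jk.1 m ^+ 2 - \sum_m jk.2 m ^+ 2 /\
    K = \sum_m jk.1 m - \sum_m jk.2 m].

Definition nonlin_index : set (nat * nat) := [set ab | (2 <= ab.1 + ab.2)%N].

Definition resonant_coef (u : R -> R[i]) (K : int) : R[i] :=
  csum nonlin_index (fun ab => alpha ab.1 ab.2 *
    csum (@resonant_set ab.1 ab.2 K) (fun jk =>
      \prod_m fcoef L u (jk.1 m) * \prod_m (fcoef L u (jk.2 m))^*)).

Definition resonant (u : R -> R[i]) : R -> R[i] := fseries L (resonant_coef u).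

End System.

(* Main.v *)
Require Import Defs.
From mathcomp Require Import all_boot all_order all_algebra finmap.
From mathcomp Require Import complex.
From mathcomp Require Import all_classical all_reals all_analysis.
From mathcomp Require Import ring lra.
From mathcomp Require Import ess_sup_inf measurable_realfun.
From mathcomp.analysis Require summability.

Set Implicit Arguments.
Unset Strict Implicit.
Unset Printing Implicit Defensive.
Import Order.TTheory GRing.Theory Num.Theory.
Import numFieldNormedType.Exports.

Local Open Scope classical_set_scope.
Local Open Scope ring_scope.
Local Open Scope complex_scope.

(* The free flow is explicit on Fourier coefficients, so the coefficient of
   rho(v(s)) at K is a sum over pairs of words (j, k) of frequencies: the word of
   total frequency K contributes alpha * \prod u_j \prod (u_k)^* times the phase
   expi (- om s (|j|^2 - |k|^2)).  After Duhamel's formula the phase of each term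
   is expi (om s (K^2 - |j|^2 + |k|^2)), up to a factor that is 1 at tauP, and
   om tauP = 2 pi: integrating over a period keeps exactly the resonant words.

   All analytic questions (membership in the Sobolev space, continuity, Bochner
   integrability) are settled by one majorant M_K, the sum of the moduli of the
   words of total frequency K.  Its weighted l^2 norm is finite because finite
   pieces of it are coefficients of trigonometric polynomials, to which the
   submultiplicativity of the norm applies.  The bound on the sup norm, evaluated
   at 0 for trigonometric polynomials with nonnegative coefficients, gives the
   embedding of the Sobolev space into l^1. *)

(** * Unconditional sums *)

(** [Hconst_admissible] bounds the norm of a product only when the product is already an element of
    the space, and [has_bochner_integral] speaks of a limit that has to be supplied. Elements are
    therefore built from their coefficients: a candidate family bounded by a multiple of M_K becomes
    an element through [ex_dominated], and only afterwards is it identified with rho(v(s)) or with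
    the Duhamel integral.

    Up to factors of modulus at most 1, one absolutely summable family over all words carries the
    computation. Grouped by the lengths of the words it gives the power series of rho at a point;
    grouped by total frequency it gives the Fourier series of rho(v(s)); its resonant part grouped
    by lengths gives the coefficient of N_rho. [csums_fiber] passes between these groupings.

    The l^1 norm of the coefficients of u is at most the norm of u, with constant 1, so the values
    of v(s) stay in the disc where the power series represents rho. Uniqueness of w holds because
    Fourier coefficients are bounded functionals and hence commute with every Bochner integral. *)

Section Normc.
Variable R : realType.
Implicit Types z w : R[i].

Lemma normc_normr z : `|z| = (normc z)%:C.
Proof. by case: z. Qed.

Lemma normc_ge0 z : 0 <= normc z.
Proof. by case: z => a b; exact: sqrtr_ge0. Qed.

Lemma normc_sum (I : Type) (r : seq I) (P : pred I) (f : I -> R[i]) :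
  normc (\sum_(i <- r | P i) f i) <= \sum_(i <- r | P i) normc (f i).
Proof.
elim/big_ind2 : _ => [|x a y b xa yb|//].
  by rewrite ComplexField.Normc.normc0.
by apply: le_trans (le_normcD _ _) _; exact: lerD.
Qed.

Lemma normc_real (a : R) : normc a%:C = `|a|.
Proof. by rewrite /= expr0n addr0 sqrtr_sqr. Qed.

Lemma normc_distC z w : normc (z - w) = normc (w - z).
Proof. by rewrite -opprB (normcN (w - z)). Qed.

Lemma normc_conj z : normc (z^*)%R = normc z.
Proof. by case: z => a b /=; rewrite sqrrN. Qed.

Lemma normc_expi (t : R) : normc (expi t) = 1.
Proof. by rewrite /= cos2Dsin2 sqrtr1. Qed.

Lemma normc_Re z : `|complex.Re z| <= normc z.
Proof.
by case: z => a b /=; rewrite -sqrtr_sqr ler_sqrt ?lerDl ?sqr_ge0// addr_ge0 ?sqr_ge0.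
Qed.

Lemma normc_Im z : `|complex.Im z| <= normc z.
Proof.
by case: z => a b /=; rewrite -sqrtr_sqr ler_sqrt ?lerDr ?sqr_ge0// addr_ge0 ?sqr_ge0.
Qed.

Lemma normc_le_ReIm z : normc z <= `|complex.Re z| + `|complex.Im z|.
Proof.
have {1}-> : z = (complex.Re z)%:C + 'i%C * (complex.Im z)%:C.
  exact: complexE.
apply: le_trans (le_normcD _ _) _; rewrite ComplexField.Normc.normcM !normc_real.
by rewrite /= expr0n add0r expr1n sqrtr1 mul1r.
Qed.

Lemma normc_prod (I : Type) (r : seq I) (f : I -> R[i]) :
  normc (\prod_(i <- r) f i) = \prod_(i <- r) normc (f i).
Proof.
elim/big_ind2 : _ => [|x a y b xa yb|//].
  by rewrite ComplexField.Normc.normc1.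
by rewrite ComplexField.Normc.normcM xa yb.
Qed.

Lemma expiD (s t : R) : expi (s + t) = expi s * expi t.
Proof.
by apply/eqP; rewrite eq_complex /= cosD sinD addrC eqxx/= [sin s * _ + _]addrC eqxx.
Qed.

Lemma expi0 : expi (0 : R) = 1.
Proof. by rewrite /expi cos0 sin0. Qed.

Lemma expiN (t : R) : expi (- t) = ((expi t)^*)%R.
Proof. by rewrite /expi cosN sinN. Qed.

End Normc.

Arguments ComplexField.Normc.normc : simpl never.
Arguments expi : simpl never.

Section UnconditionalSums.
Variables (R : realType) (I : choiceType).
Implicit Types (f g : I -> R[i]) (p : I -> R).

(** The working form of [has_csum]: e is real, whereas distances in [R[i]^o] are elements of [R[i]].
    Restricted index sets are expressed by extending the family by zero. *)
Definition csums f s := forall e : R, 0 < e -> exists F0 : {fset I},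
  forall F : {fset I}, (F0 `<=` F)%fset -> normc (\sum_(i <- F) f i - s) <= e.

Definition absum f (B : R) := forall F : {fset I}, \sum_(i <- F) normc (f i) <= B.

Lemma partial_sumE (f : I -> R[i]^o) (F : {fset I}) :
  summability.partial_sum f F = \sum_(i <- F) f i.
Proof. by rewrite /summability.partial_sum big_seq_fsetE. Qed.

Lemma has_csumP (D : set I) f s :
  has_csum D f s <-> csums (patch (fun=> 0) D f) s.
Proof.
split => [/cvgrPdist_le fs e e0|fs].
  have /fs [F0 _ F0e] : 0 < e%:C by rewrite ltcR.
  exists F0 => F /F0e /=.
  by rewrite partial_sumE normc_normr lecR normc_distC.
apply/cvgrPdist_le => e e0.
have eE : (complex.Re e)%:C = e by apply: RRe_real; exact: gtr0_real.
have /fs [F0 F0e] : 0 < complex.Re e by rewrite -ltcR eE.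
exists F0 => // F /F0e /=.
by rewrite partial_sumE -eE normc_normr lecR normc_distC.
Qed.

Lemma has_csumTP f s : has_csum setT f s <-> csums f s.
Proof. by rewrite has_csumP patch_setT. Qed.

Lemma has_csumE (D : set I) f s : has_csum D f s -> csum D f = s.
Proof. exact: norm_cvg_lim. Qed.

Lemma csums_unique f s t : csums f s -> csums f t -> s = t.
Proof. by move=> /has_csumTP fs /has_csumTP ft; exact: has_csum_unique fs ft. Qed.

Lemma csums_lin (a s t : R[i]) f g :
  csums f s -> csums g t -> csums (fun i => a * f i + g i) (a * s + t).
Proof. by rewrite -!has_csumTP; exact: has_csum_lin. Qed.

Lemma csums0 : csums (fun=> 0) 0.
Proof. by apply/has_csumTP; exact: has_csum0. Qed.

Lemma csumsZ (a s : R[i]) f : csums f s -> csums (fun i => a * f i) (a * s).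
Proof.
move=> /(csums_lin a)/(_ csums0); rewrite addr0.
by under eq_fun do rewrite addr0.
Qed.

Lemma csumsD s t f g : csums f s -> csums g t -> csums (fun i => f i + g i) (s + t).
Proof.
move=> /(csums_lin 1) fs /fs; rewrite mul1r.
by under eq_fun do rewrite mul1r.
Qed.

Lemma csums_finite f (r : seq I) : uniq r ->
  (forall i, i \notin r -> f i = 0) -> csums f (\sum_(i <- r) f i).
Proof.
move=> ur r0 e e0; exists [fset i in r]%fset => F rF.
suff -> : \sum_(i <- F) f i = \sum_(i <- r) f i.
  by rewrite subrr ComplexField.Normc.normc0 ltW.
rewrite (bigID (mem r))/= [X in _ + X]big1 ?addr0; last by move=> i /r0.
rewrite -big_filter; apply: perm_big; apply: uniq_perm => //.
  by rewrite filter_uniq.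
move=> i; rewrite mem_filter andb_idr// => ir.
by move/fsubsetP: rF; apply; rewrite inE.
Qed.

Lemma csums_single f (j : I) : (forall i, i != j -> f i = 0) -> csums f (f j).
Proof.
move=> j0; rewrite -[f j](big_seq1 +%R j f); apply: csums_finite => // i.
by rewrite inE => /j0.
Qed.

Lemma ler_sum_sub p (r s : seq I) : uniq r -> (forall i, 0 <= p i) ->
  {subset r <= s} -> \sum_(i <- r) p i <= \sum_(i <- s) p i.
Proof.
move=> + p0; elim: r s => [|x r IH] s.
  by rewrite big_nil => _ _; exact: sumr_ge0.
move=> /= /andP[xr ur] rs; have xs : x \in s by apply: rs; rewrite inE eqxx.
rewrite big_cons (perm_big _ (perm_to_rem xs)) big_cons lerD2l; apply: IH => // y yr.
have : y \in x :: rem x s by rewrite -(perm_mem (perm_to_rem xs)) rs// inE yr orbT.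
by rewrite inE => /predU1P[yx|//]; rewrite -yx yr in xr.
Qed.

(** Repetitions in [s] only increase the right-hand side. The lists of words that later cover a
    finite set are flattened lists, whose uniqueness then need not be proved. *)
Lemma ler_sum_supp p (r s : seq I) : uniq r -> (forall i, 0 <= p i) ->
  (forall i, i \in r -> i \notin s -> p i = 0) ->
  \sum_(i <- r) p i <= \sum_(i <- s) p i.
Proof.
move=> ur p0 sp; rewrite (bigID (mem s))/= [X in _ + X]big1_seq ?addr0; last first.
  by move=> i /andP[is_ ir]; exact: sp.
rewrite -big_filter; apply: ler_sum_sub => //; first exact: filter_uniq.
by move=> i; rewrite mem_filter => /andP[].
Qed.

Lemma absum_seq f B (r : seq I) : absum f B -> uniq r ->
  \sum_(i <- r) normc (f i) <= B.
Proof.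
move=> fB ur; rewrite (_ : \sum_(i <- r) _ = \sum_(i <- [fset i in r]%fset) normc (f i)).
  exact: fB.
by apply: perm_big; apply: uniq_perm => // i; rewrite inE.
Qed.

Lemma absum_le f g B : absum g B -> (forall i, normc (f i) <= normc (g i)) -> absum f B.
Proof. by move=> gB fg F; apply: le_trans (gB F); exact: ler_sum. Qed.

Lemma absum_ge0 f B : absum f B -> 0 <= B.
Proof. by move=> /(_ fset0); rewrite big_seq_fset0. Qed.

Lemma absum_term f B i : absum f B -> normc (f i) <= B.
Proof. by move=> /(_ [fset i]%fset); rewrite big_seq_fset1. Qed.

Lemma sum_fsetU p (A B : {fset I}) : [disjoint A & B]%fset ->
  \sum_(i <- (A `|` B)%fset) p i = \sum_(i <- A) p i + \sum_(i <- B) p i.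
Proof.
move=> AB; rewrite -big_cat; apply: perm_big; apply: uniq_perm => //.
  rewrite cat_uniq !fset_uniq andbT/=; apply/hasPn => i iB.
  by move: AB; rewrite fdisjoint_sym => /fdisjointP/(_ i iB).
by move=> i; rewrite mem_cat inE.
Qed.

(** The number m is the supremum of the finite sums. Both bounds are used directly in [ex_majorant],
    where m is the value of the majorant. *)
Lemma nonneg_sums_cvg p B : (forall i, 0 <= p i) ->
  (forall F : {fset I}, \sum_(i <- F) p i <= B) ->
  exists m : R, (forall F : {fset I}, \sum_(i <- F) p i <= m) /\
    forall e, 0 < e -> exists F0 : {fset I}, m - e <= \sum_(i <- F0) p i.
Proof.
move=> p0 pB; pose E := [set \sum_(i <- F) p i | F in [set: {fset I}]].
have supE : has_sup E.
  split; first by exists (\sum_(i <- fset0) p i), fset0.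
  by exists B => _ [F _ <-].
exists (sup E); split=> [F|e e0]; first by apply: ub_le_sup; [exact: supE.2|exists F].
by have [_ [F _ <-] /ltW] := sup_adherent e0 supE; exists F.
Qed.

(** Once a finite sum is within e of the supremum of all of them, a disjoint finite set can add at
    most e. *)
Lemma absum_tail f B : absum f B -> forall e, 0 < e -> exists F0 : {fset I},
  forall F : {fset I}, [disjoint F0 & F]%fset -> \sum_(i <- F) normc (f i) <= e.
Proof.
move=> fB e e0.
have [m [pm mp]] := nonneg_sums_cvg (fun i => normc_ge0 (f i)) fB.
have [F0 F0e] := mp e e0; exists F0 => F dF.
have := pm (F0 `|` F)%fset; rewrite sum_fsetU//.
lra.
Qed.

Lemma nonneg_csums p B : (forall i, 0 <= p i) ->
  (forall F : {fset I}, \sum_(i <- F) p i <= B) ->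
  exists m : R, csums (fun i => (p i)%:C) m%:C.
Proof.
move=> p0 pB; have [m [pm mp]] := nonneg_sums_cvg p0 pB.
exists m => e e0; have [F0 F0e] := mp e e0; exists F0 => F FF.
rewrite (_ : _ - _ = (\sum_(i <- F) p i - m)%:C) ?normc_real ?ler_norml; last first.
  by rewrite rmorphB rmorph_sum.
apply/andP; split; last by rewrite lerBlDr (le_trans (pm F))// lerDr ltW.
have := @ler_sum_sub p F0 F (fset_uniq _) p0 (fsubsetP FF); lra.
Qed.

(** Real and imaginary parts are split into positive and negative parts; each of the four
    nonnegative families is dominated by the moduli. *)
Lemma absum_csums f B : absum f B -> exists s, csums f s.
Proof.
move=> fB.
have part (q : I -> R) : (forall i, 0 <= q i) -> (forall i, q i <= normc (f i)) ->
    exists m : R, csums (fun i => (q i)%:C) m%:C.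
  move=> q0 qf; apply: (@nonneg_csums q B) => // F.
  by apply: le_trans (fB F); exact: ler_sum.
have realpart (q : I -> R) : (forall i, `|q i| <= normc (f i)) ->
    exists m : R, csums (fun i => (q i)%:C) m%:C.
  move=> qf.
  have [a af] : exists m : R, csums (fun i => (Num.max (q i) 0)%:C) m%:C.
    apply: part => i; first by rewrite le_max lexx orbT.
    by rewrite ge_max normc_ge0 (le_trans (ler_norm _)).
  have [b bf] : exists m : R, csums (fun i => (Num.max (- q i) 0)%:C) m%:C.
    apply: part => i; first by rewrite le_max lexx orbT.
    by rewrite ge_max normc_ge0 andbT (le_trans (ler_norm _))// normrN.
  exists (a - b).
  have := csums_lin (-1) bf af.
  rewrite mulN1r addrC -rmorphB; congr csums; apply/funext => i.
  rewrite mulN1r addrC -rmorphB; congr (_%:C).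
  by have [q0|q0] := leP (q i) 0;
    [rewrite max_l ?oppr_ge0// sub0r opprK|rewrite max_r ?subr0// oppr_le0 ltW].
have [a af] := realpart (fun i => complex.Re (f i)) (fun i => normc_Re _).
have [b bf] := realpart (fun i => complex.Im (f i)) (fun i => normc_Im _).
exists ('i%C * b%:C + a%:C).
have := csums_lin 'i%C bf af; congr csums; apply/funext => i.
by rewrite [RHS]complexE addrC.
Qed.

Lemma csums_norm_le f s B : csums f s -> absum f B -> normc s <= B.
Proof.
move=> fs fB; apply/ler_addgt0Pr => e e0; have [F0 /(_ F0 (fsubset_refl _)) F0e] := fs e e0.
rewrite -[s](subKr (\sum_(i <- F0) f i)).
apply: le_trans (le_normcD _ _) _; rewrite (normcN (_ - _)); apply: lerD => //.
by apply: le_trans (normc_sum _ _ _) (fB F0).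
Qed.

(** The set [F0] enters only through tails of moduli, so one [F0] serves all families with smaller
    moduli. The estimates uniform in time or space rest on this. *)
Lemma csums_approx f s (F0 : {fset I}) e : csums f s ->
  (forall F : {fset I}, [disjoint F0 & F]%fset -> \sum_(i <- F) normc (f i) <= e) ->
  normc (s - \sum_(i <- F0) f i) <= e.
Proof.
move=> fs F0e; pose g i := if i \in F0 then 0 else f i.
have gs : csums g (s - \sum_(i <- F0) f i).
  pose h i := if i \in F0 then f i else 0.
  have hs : csums h (\sum_(i <- F0) f i).
    rewrite (_ : \sum_(i <- F0) f i = \sum_(i <- F0) h i).
      by apply: csums_finite => // i; rewrite /h => /negbTE ->.
    by rewrite !big_seq; apply: eq_bigr => i iF; rewrite /h iF.
  have := csums_lin (-1) hs fs; rewrite mulN1r addrC; congr csums; apply/funext => i.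
  by rewrite /g /h; case: ifP => _; rewrite ?mulr0 ?add0r// mulN1r addNr.
apply: (csums_norm_le gs) => F.
rewrite (_ : \sum_(i <- F) _ = \sum_(i <- (F `\` F0)%fset) normc (f i)).
  apply: F0e; apply/fdisjointP => i iF0; rewrite inE iF0//.
rewrite (bigID (mem F0))/= big1 ?add0r; last first.
  by move=> i iF0; rewrite /g iF0 ComplexField.Normc.normc0.
rewrite big_fset_condE/=.
rewrite (_ : [fset i | i in F & i \notin F0]%fset = (F `\` F0)%fset); last first.
  by apply/fsetP => i; rewrite !inE andbC.
by rewrite !big_seq; apply: eq_bigr => i; rewrite /g !inE => /andP[/negbTE -> _].
Qed.

End UnconditionalSums.

Lemma absum_real (R : realType) (I : choiceType) (p : I -> R) B :
  (forall i, 0 <= p i) -> (forall F : {fset I}, \sum_(i <- F) p i <= B) ->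
  absum (fun i => (p i)%:C) B.
Proof.
move=> p0 pB F; under eq_bigr do rewrite normc_real ger0_norm//; exact: pB.
Qed.

(** * Rearrangement and products of unconditional sums *)

Section Fubini.
Variables (R : realType) (I J : choiceType).

(** Let [F0] carry all of [f] up to e. If [A] contains the image of [F0], the sum of [g] over [A] is
    the sum of [f] over a set containing [F0], so what is left out has moduli of total at most e. *)
Lemma csums_fiber (f : I -> R[i]) (k : I -> J) (g : J -> R[i]) s B : absum f B ->
  (forall j, csums (fun i => if k i == j then f i else 0) (g j)) ->
  csums f s -> csums g s.
Proof.
move=> fB fg fs e e0; have [F0 F0e] := absum_tail fB e0.
exists [fset k i | i in F0]%fset => A kA.
have sumA : csums (fun i => if k i \in A then f i else 0) (\sum_(j <- A) g j).
  rewrite (_ : (fun i => _) = fun i => \sum_(j <- A) (if k i == j then f i else 0)).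
    elim: (enum_fset A) => [|j r IH].
      rewrite big_nil; under [X in csums X]eq_fun do rewrite big_nil.
      exact: csums0.
    rewrite big_cons; under [X in csums X]eq_fun do rewrite big_cons.
    exact: csumsD.
  apply/funext => i; case: ifP => iA.
    rewrite (bigD1_seq (k i))//= eqxx big1 ?addr0// => j.
    by rewrite eq_sym => /negbTE ->.
  rewrite big_seq big1// => j jA; case: eqP => // kij.
  by rewrite -kij iA in jA.
have := csums_lin (-1) fs sumA; rewrite mulN1r addrC => /csums_norm_le; apply => F.
pose F' := [fset i in F | k i \notin A]%fset.
apply: le_trans (F0e F' _); last first.
  apply/fdisjointP => i iF0; rewrite !inE negb_and negbK orbC.
  by move/fsubsetP: kA => ->//; apply: in_imfset.
rewrite (bigID (fun i => k i \in A))/= big1 ?add0r; last first.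
  by move=> i ->; rewrite mulN1r addNr ComplexField.Normc.normc0.
rewrite big_fset_condE/= le_eqVlt; apply/orP; left; apply/eqP.
rewrite (_ : [fset i | i in F & k i \notin A]%fset = F'); last first.
  by apply/fsetP => i; rewrite !inE.
rewrite !big_seq; apply: eq_bigr => i; rewrite !inE/= => /andP[_ /negbTE ->].
by rewrite addr0 mulN1r (normcN (f i)).
Qed.

(** The converse of [csums_fiber]: [f] has some sum, which [csums_fiber] and uniqueness force to be
    [s]. *)
Lemma csums_total (f : I -> R[i]) (k : I -> J) (g : J -> R[i]) s B : absum f B ->
  (forall j, csums (fun i => if k i == j then f i else 0) (g j)) ->
  csums g s -> csums f s.
Proof.
move=> fB fg gs; have [t ft] := absum_csums fB.
by rewrite (csums_unique gs (csums_fiber fB fg ft)).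
Qed.

(* phi restricts to a bijection from the support of g to that of f *)
Lemma csums_reindex (f : I -> R[i]) (g : J -> R[i]) (phi : J -> I) (psi : I -> J) s B :
  absum f B -> (forall j, g j != 0 -> psi (phi j) = j /\ f (phi j) = g j) ->
  (forall i, f i != 0 -> phi (psi i) = i /\ g (psi i) = f i) ->
  csums f s -> csums g s.
Proof.
(* The fibre of [psi] over [j] meets the support of [f] in at most the point [phi j]. *)
move=> fB phiK psiK; apply: (@csums_fiber f psi g s B) => // j.
have [gj|gj] := eqVneq (g j) 0.
  rewrite gj (_ : (fun i => _) = fun=> 0); first exact: csums0.
  apply/funext => i; case: eqP => // ij; have [//|/psiK[_]] := eqVneq (f i) 0.
  by rewrite ij gj => ->.
have [pj fpj] := phiK _ gj.
rewrite -fpj [f (phi j)](_ : _ = (if psi (phi j) == j then f (phi j) else 0)); last first.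
  by rewrite pj eqxx.
apply: (csums_single (f := fun i => if psi i == j then f i else 0)) => i ij.
case: eqP => // pij; have [//|/psiK[pi _]] := eqVneq (f i) 0.
by rewrite -pi pij eqxx in ij.
Qed.

(** A finite set of pairs lies in the rectangle of its two projections, where the sum factors. *)
Lemma absum_prod (f : I -> R[i]) (g : J -> R[i]) A B : absum f A -> absum g B ->
  absum (fun ij : I * J => f ij.1 * g ij.2) (A * B).
Proof.
move=> fA gB F.
pose F1 := undup [seq ij.1 | ij <- F]; pose F2 := undup [seq ij.2 | ij <- F].
apply: (@le_trans _ _ (\sum_(ij <- [seq (i, j) | i <- F1, j <- F2])
    normc (f ij.1 * g ij.2))).
  apply: ler_sum_sub => // [i|[i j] ijF]; first exact: normc_ge0.
  apply/allpairsP; exists (i, j); split => //=; rewrite mem_undup;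
  by apply/mapP; exists (i, j).
rewrite big_allpairs_dep/=.
under eq_bigr do under eq_bigr do rewrite ComplexField.Normc.normcM.
rewrite -big_distrlr/=; apply: ler_pM.
- by apply: sumr_ge0 => *; exact: normc_ge0.
- by apply: sumr_ge0 => *; exact: normc_ge0.
- by apply: absum_seq fA _; exact: undup_uniq.
- by apply: absum_seq gB _; exact: undup_uniq.
Qed.

End Fubini.

Lemma csums_prod (R : realType) (I J : choiceType) (f : I -> R[i]) (g : J -> R[i]) A B s t :
  absum f A -> absum g B -> csums f s -> csums g t ->
  csums (fun ij : I * J => f ij.1 * g ij.2) (s * t).
Proof.
move=> fA gB fs gt.
apply: (csums_total (k := fst) (g := fun i => t * f i) (absum_prod fA gB)).
  move=> i; apply: (csums_reindex (f := fun j => f i * g j) (phi := snd)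
    (psi := fun j => (i, j)) (B := normc (f i) * B)).
  - move=> F; under eq_bigr do rewrite ComplexField.Normc.normcM.
    by rewrite -mulr_sumr ler_wpM2l ?normc_ge0.
  - by move=> [i' j] /=; case: (eqVneq i' i) => [->//|_]; rewrite eqxx.
  - by move=> j _; rewrite /= eqxx.
  - by rewrite mulrC; exact: csumsZ.
by rewrite mulrC; exact: csumsZ.
Qed.

(** * Integrals of uniformly continuous functions *)

Section UniformContinuity.
Variable R : realType.
Implicit Types f g : R -> R[i].

(** Uniform continuity is asked on the whole line: exponentials have it, finite sums and uniform
    limits keep it, and it yields integrability on every segment. *)
Definition ucont f := forall e : R, 0 < e -> exists2 d : R, 0 < d &
  forall x y, `|x - y| < d -> normc (f x - f y) <= e.

Lemma ucont_cst (c : R[i]) : ucont (fun=> c).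
Proof.
by move=> e e0; exists 1 => // x y _; rewrite subrr ComplexField.Normc.normc0 ltW.
Qed.

Lemma ucontD f g : ucont f -> ucont g -> ucont (fun x => f x + g x).
Proof.
move=> fu gu e e0; have e2 : 0 < e / 2 by rewrite divr_gt0.
have [d d0 fd] := fu _ e2; have [d' d'0 gd] := gu _ e2.
exists (Num.min d d'); first by rewrite lt_min d0.
move=> x y; rewrite lt_min => /andP[/fd fxy /gd gxy].
by rewrite opprD addrACA [e]splitr (le_trans (le_normcD _ _))// lerD.
Qed.

Lemma ucontZ (c : R[i]) f : ucont f -> ucont (fun x => c * f x).
Proof.
move=> fu e e0; have n0 : 0 < normc c + 1 by rewrite ltr_wpDl// normc_ge0.
have [d d0 fd] := fu _ (divr_gt0 e0 n0); exists d => // x y /fd fxy.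
rewrite -mulrBr ComplexField.Normc.normcM.
rewrite (@le_trans _ _ ((normc c + 1) * (e / (normc c + 1))))//.
  by apply: ler_pM; rewrite ?normc_ge0// lerDl.
by rewrite mulrC divfK ?gt_eqF.
Qed.

Lemma ucont_sum (I : Type) (r : seq I) (f : I -> R -> R[i]) :
  (forall i, ucont (f i)) -> ucont (fun x => \sum_(i <- r) f i x).
Proof.
move=> fu; elim: r => [|i r IH].
  by under eq_fun do rewrite big_nil; exact: ucont_cst.
by under eq_fun do rewrite big_cons; exact: ucontD.
Qed.

Lemma ucont_limit f : (forall e, 0 < e -> exists2 g, ucont g &
  forall x, normc (f x - g x) <= e) -> ucont f.
Proof.
move=> fg e e0; have e3 : 0 < e / 3 by rewrite divr_gt0.
have [g gu fge] := fg _ e3; have [d d0 gd] := gu _ e3.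
exists d => // x y /gd gxy.
have -> : f x - f y = (f x - g x) + ((g x - g y) + (g y - f y)) by ring.
apply: le_trans (le_normcD _ _) _.
have := le_normcD (g x - g y) (g y - f y); have := fge x.
have := fge y; rewrite normc_distC; lra.
Qed.

Lemma ucont_Re f : ucont f -> continuous (fun x => complex.Re (f x)).
Proof.
move=> fu x; apply/cvgrPdist_le => e e0; have [d d0 fd] := fu _ e0.
near=> y; rewrite -raddfB; apply: le_trans (normc_Re _) _.
by apply: fd; near: y; apply/nbhs_ballP; exists d.
Unshelve. all: by end_near. Qed.

Lemma ucont_Im f : ucont f -> continuous (fun x => complex.Im (f x)).
Proof.
move=> fu x; apply/cvgrPdist_le => e e0; have [d d0 fd] := fu _ e0.
near=> y; rewrite -raddfB; apply: le_trans (normc_Im _) _.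
by apply: fd; near: y; apply/nbhs_ballP; exists d.
Unshelve. all: by end_near. Qed.

Lemma ucont_expi (a : R) : ucont (fun x => expi (a * x)).
Proof.
have u1 : ucont (@expi R).
  move=> e e0; have e2 : 0 < e / 2 by rewrite divr_gt0.
  have /cvgrPdist_le/(_ _ e2) := @continuous_cos R 0.
  move=> /nbhs_ballP[d /= d0 cd].
  have /cvgrPdist_le/(_ _ e2) := @continuous_sin R 0.
  move=> /nbhs_ballP[d' /= d'0 sd].
  exists (Num.min d d'); first by rewrite lt_min d0.
  move=> x y; rewrite lt_min => /andP[xyd xyd'].
  rewrite -[leLHS]/(normc (expi x - expi y)).
  (* Since [expi y] has modulus 1, multiplicativity reduces uniform continuity to continuity at
     0. *)
  have -> : expi x - expi y = (expi (x - y) - 1) * expi y.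
    by rewrite mulrBl mul1r -expiD subrK.
  rewrite ComplexField.Normc.normcM.
  rewrite normc_expi mulr1; apply: le_trans (normc_le_ReIm _) _; rewrite /= [leRHS]splitr.
  apply: lerD.
    have /cd : ball (0 : R) d (x - y) by rewrite /ball/= sub0r normrN.
    by rewrite /= cos0 distrC.
  have /sd : ball (0 : R) d' (x - y) by rewrite /ball/= sub0r normrN.
  by rewrite /= sin0 sub0r normrN subr0.
move=> e e0; have [d d0 ud] := u1 _ e0.
have a1 : 0 < `|a| + 1 by rewrite ltr_wpDl.
exists (d / (`|a| + 1)); first by rewrite divr_gt0.
move=> x y xy; apply: ud; rewrite -mulrBr normrM.
apply: (@le_lt_trans _ _ ((`|a| + 1) * `|x - y|)).
  by rewrite ler_wpM2r// lerDl.
by rewrite mulrC -ltr_pdivlMr.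
Qed.

End UniformContinuity.

Section BoundedSeries.
Variables (R : realType) (I : choiceType) (T : I -> R[i]) (B : R).
Hypothesis TB : absum T B.

Lemma absumM (c : I -> R[i]) : (forall i, normc (c i) <= 1) ->
  absum (fun i => T i * c i) B.
Proof.
move=> c1; apply: absum_le TB _ => i; rewrite ComplexField.Normc.normcM.
by rewrite ler_piMr ?normc_ge0.
Qed.

Lemma series_approx (X : Type) (phi : X -> I -> R[i]) (S : X -> R[i]) :
  (forall x i, normc (phi x i) <= 1) ->
  (forall x, csums (fun i => T i * phi x i) (S x)) ->
  forall e, 0 < e -> exists F0 : {fset I},
    forall x, normc (S x - \sum_(i <- F0) T i * phi x i) <= e.
Proof.
move=> phi1 TS e e0; have [F0 F0e] := absum_tail TB e0; exists F0 => x.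
apply: csums_approx (TS x) _ => F /F0e; apply: le_trans.
apply: ler_sum => i _; rewrite ComplexField.Normc.normcM.
by rewrite ler_piMr ?normc_ge0.
Qed.

Lemma ucont_series (phi : R -> I -> R[i]) (S : R -> R[i]) :
  (forall x i, normc (phi x i) <= 1) -> (forall i, ucont (phi^~ i)) ->
  (forall x, csums (fun i => T i * phi x i) (S x)) -> ucont S.
Proof.
move=> phi1 phiu TS; apply: ucont_limit => e e0.
have [F0 F0e] := series_approx phi1 TS e0.
by eexists; [|exact: F0e]; apply: ucont_sum => i; exact: ucontZ.
Qed.

End BoundedSeries.

Lemma Rintegral_le_bound (R : realType) d (T : measurableType d)
    (mu : {measure set T -> \bar R}) (D : set T) (v : R) (f : T -> R) m :
  measurable D -> mu D = v%:E -> mu.-integrable D (EFin \o f) ->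
  (forall x, D x -> `|f x| <= m) -> `|\int[mu]_(x in D) f x| <= v * m.
Proof.
move=> mD Dv fi fm; apply: le_trans (le_normr_Rintegral mD fi) _.
have -> : v * m = \int[mu]_(x in D) m by rewrite Rintegral_cst// Dv mulrC.
apply: le_Rintegral => //; first exact: (integrable_norm fi).
apply/integrableP; split; first exact/measurable_EFinP.
rewrite (eq_integral (cst `|m|%:E))// integral_cst// Dv -EFinM ltry//.
Qed.

Section Integration.
Variables (R : realType) (t : R).
Hypothesis t0 : 0 <= t.
Implicit Types f g : R -> R[i].
Local Notation mu := (@lebesgue_measure R).
Local Notation D := (`[0, t]%classic : set (measurableTypeR R)).

Lemma measurable_seg0 : measurable D. Proof. exact: measurable_itv. Qed.
Local Hint Resolve measurable_seg0 : core.

Lemma measure_seg0 : mu D = t%:E.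
Proof.
rewrite lebesgue_measure_itv/= lte_fin; have [//|] := ltP 0 t; rewrite ?sube0//.
by move=> t00; congr EFin; apply/eqP; rewrite eq_le t0.
Qed.

Lemma continuous_integrable (f : R -> R) : continuous f ->
  mu.-integrable D (EFin \o f).
Proof.
move=> fc; apply: continuous_compact_integrable; first exact: segment_compact.
exact: continuous_subspaceT.
Qed.

Lemma ucont_integrable f : ucont f -> cintegrable D f.
Proof.
by move=> fu; split; apply: continuous_integrable; [exact: ucont_Re|exact: ucont_Im].
Qed.

Lemma cintegrableZ (c : R[i]) f : cintegrable D f -> cintegrable D (fun x => c * f x).
Proof.
case: c => a b [f1 f2]; split.
- have := integrableB measurable_seg0 (integrableZl measurable_seg0 a f1)
    (integrableZl measurable_seg0 b f2).
  by congr (integrable _ _ _); apply/funext => x /=; case: (f x).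
- have := integrableD measurable_seg0 (integrableZl measurable_seg0 a f2)
    (integrableZl measurable_seg0 b f1).
  by congr (integrable _ _ _); apply/funext => x /=; case: (f x).
Qed.

Lemma cintegralZ (c : R[i]) f : cintegrable D f ->
  cintegral D (fun x => c * f x) = c * cintegral D f.
Proof.
case: c => a b [f1 f2]; rewrite /cintegral.
apply/eqP; rewrite eq_complex/=; apply/andP; split; apply/eqP.
- rewrite -RintegralZl// -[in RHS]RintegralZl// -RintegralB//; last 2 first.
    exact: (integrableZl measurable_seg0 a f1).
    exact: (integrableZl measurable_seg0 b f2).
  by congr (Rintegral _ _ _); apply/funext => x /=; case: (f x).
- rewrite -RintegralZl// -[in RHS]RintegralZl// -RintegralD//; last 2 first.
    exact: (integrableZl measurable_seg0 a f2).
    exact: (integrableZl measurable_seg0 b f1).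
  by congr (Rintegral _ _ _); apply/funext => x /=; case: (f x).
Qed.

Lemma cintegrableD f g : cintegrable D f -> cintegrable D g ->
  cintegrable D (fun x => f x + g x).
Proof.
move=> fi gi; have := cintegrable_lin 1 measurable_seg0 fi gi.
by congr (cintegrable _ _); apply/funext => x; rewrite rmorph1 mul1r.
Qed.

Lemma cintegralD f g : cintegrable D f -> cintegrable D g ->
  cintegral D (fun x => f x + g x) = cintegral D f + cintegral D g.
Proof.
move=> fi gi; have := cintegral_lin 1 measurable_seg0 fi gi.
rewrite rmorph1 mul1r => <-.
by congr (cintegral _ _); apply/funext => x; rewrite mul1r.
Qed.

Lemma cintegrableB f g : cintegrable D f -> cintegrable D g ->
  cintegrable D (fun x => f x - g x).
Proof.
move=> fi gi; have := cintegrableD fi (cintegrableZ (-1) gi).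
by congr (cintegrable _ _); apply/funext => x; rewrite mulN1r.
Qed.

Lemma cintegralB f g : cintegrable D f -> cintegrable D g ->
  cintegral D (fun x => f x - g x) = cintegral D f - cintegral D g.
Proof.
move=> fi gi; have := cintegralD fi (cintegrableZ (-1) gi).
rewrite cintegralZ// mulN1r => <-.
by congr (cintegral _ _); apply/funext => x; rewrite mulN1r.
Qed.

Lemma cintegral_sum (I : Type) (r : seq I) (f : I -> R -> R[i]) :
  (forall i, cintegrable D (f i)) ->
  cintegrable D (fun x => \sum_(i <- r) f i x) /\
  cintegral D (fun x => \sum_(i <- r) f i x) = \sum_(i <- r) cintegral D (f i).
Proof.
move=> fi; elim: r => [|i r [IH1 IH2]].
  have -> : (fun x => \sum_(i <- [::]) f i x) = fun=> 0.
    by apply/funext => x; rewrite big_nil.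
  by rewrite big_nil; split; [exact: cintegrable0|rewrite /cintegral /Rintegral !integral0].
have -> : (fun x => \sum_(i <- i :: r) f i x) = fun x => f i x + \sum_(i <- r) f i x.
  by apply/funext => x; rewrite big_cons.
by rewrite big_cons -IH2; split; [exact: cintegrableD|exact: cintegralD].
Qed.

(** The factor 2 comes from bounding the real and imaginary parts separately. *)
Lemma cintegral_bound f m : cintegrable D f ->
  (forall x, 0 <= x <= t -> normc (f x) <= m) ->
  normc (cintegral D f) <= 2 * t * m.
Proof.
move=> [f1 f2] fm; apply: le_trans (normc_le_ReIm _) _ => /=.
rewrite -mulrA mulr2n mulrDl mul1r; apply: lerD.
  apply: (Rintegral_le_bound measurable_seg0 measure_seg0 f1) => x.
  by rewrite /= in_itv/= => /fm; exact/le_trans/normc_Re.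
apply: (Rintegral_le_bound measurable_seg0 measure_seg0 f2) => x.
by rewrite /= in_itv/= => /fm; exact/le_trans/normc_Im.
Qed.

(** Termwise integration by uniform convergence: outside [F0] the series is small uniformly in x,
    because its moduli are at most those of [T]. *)
Lemma cintegral_series (I : choiceType) (T : I -> R[i]) B (phi : R -> I -> R[i])
    (S : R -> R[i]) : absum T B ->
  (forall x i, normc (phi x i) <= 1) -> (forall i, ucont (phi^~ i)) ->
  (forall x, csums (fun i => T i * phi x i) (S x)) ->
  csums (fun i => T i * cintegral D (phi^~ i)) (cintegral D S).
Proof.
move=> TB phi1 phiu TS e e0.
(* The factor 2 t is that of [cintegral_bound]; the added 1 keeps the denominator positive when t =
   0. *)
pose d := e / (2 * t + 1).
have t1 : 0 < 2 * t + 1 by rewrite ltr_wpDl// mulr_ge0.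
have d0 : 0 < d by rewrite divr_gt0.
have [F0 F0e] := absum_tail TB d0; exists F0 => F FF.
have pI i : cintegrable D (phi^~ i) by exact: ucont_integrable.
have SI : cintegrable D S by apply: ucont_integrable; exact: ucont_series TS.
have [sI sE] := cintegral_sum F (fun i => cintegrableZ (T i) (pI i)).
rewrite (_ : \sum_(i <- F) _ = cintegral D (fun x => \sum_(i <- F) T i * phi x i)).
  rewrite normc_distC -cintegralB//; apply: (@le_trans _ _ (2 * t * d)).
    apply: cintegral_bound => [|x _]; first exact: cintegrableB.
    apply: csums_approx (TS x) _ => A FA; apply: le_trans (F0e A _).
      apply: ler_sum => i _; rewrite ComplexField.Normc.normcM.
      by rewrite ler_piMr ?normc_ge0.
    by apply/fdisjointP => i /(fsubsetP FF); exact/fdisjointP.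
  by rewrite /d mulrCA ler_piMr ?(ltW e0)// ler_pdivrMr// mul1r lerDl.
by rewrite sE; apply: eq_bigr => i _; rewrite cintegralZ.
Qed.

End Integration.

(** Lipschitz dependence on the upper end of integration, needed for the continuity of w. *)
Lemma cintegral_itvB (R : realType) (f : R -> R[i]) (a b m : R) :
  ucont f -> (forall s, normc (f s) <= m) ->
  0 <= a <= b -> normc (cintegral `[0, b] f - cintegral `[0, a] f) <= 2 * (b - a) * m.
Proof.
move=> fu fm /andP[a0 ab]; have b0 := le_trans a0 ab.
have [f1 f2] := ucont_integrable b fu.
have mab : measurable (`]a, b]%classic : set (measurableTypeR R)) by exact: measurable_itv.
have vab : @lebesgue_measure R (`]a, b]%classic : set (measurableTypeR R)) = (b - a)%:E.
  rewrite lebesgue_measure_itv/= lte_fin; case: ltP => [//|ba].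
  by rewrite (_ : b = a) ?subrr//; apply/eqP; rewrite eq_le ba ab.
have sab : `]a, b]%classic `<=` `[0, b]%classic.
  by move=> s /=; rewrite !in_itv/= => /andP[/ltW as' ->]; rewrite (le_trans a0 as').
have m0b : measurable (`[0, b]%classic : set (measurableTypeR R)) by exact: measurable_itv.
apply: le_trans (normc_le_ReIm _) _; rewrite -mulrA mulr2n mulrDl mul1r /cintegral.
apply: lerD.
- rewrite [complex.Re _]/= Rintegral_itvB//.
  apply: (Rintegral_le_bound mab vab) => [|s _]; first exact: integrableS f1.
  exact: le_trans (normc_Re _) (fm s).
- rewrite [complex.Im _]/= Rintegral_itvB//.
  apply: (Rintegral_le_bound mab vab) => [|s _]; first exact: integrableS f2.
  exact: le_trans (normc_Im _) (fm s).
Qed.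

Lemma expi_2pi (R : realType) (n : int) : expi (2 * pi * n%:~R : R) = 1.
Proof.
have posn (m : nat) : expi (2 * pi * m%:R : R) = 1.
  elim: m => [|m IH]; first by rewrite mulr0 expi0.
  rewrite -[m.+1%:R]natr1 mulrDr mulr1 expiD IH mul1r /expi mulr_natl.
  by rewrite -[pi *+ 2]add0r sinD2pi cosD2pi sin0 cos0.
case: n => m; first exact: posn.
by rewrite NegzE mulrNz mulrN expiN posn rmorph1.
Qed.

Section ExponentialIntegrals.
Variables (R : realType) (T : R).
Hypothesis T0 : 0 < T.

Lemma cintegral_cst (c : R[i]) : cintegral `[0, T] (fun=> c) = T%:C * c.
Proof.
have E (a : R) : \int[lebesgue_measure]_(x in `[0, T]) a = T * a.
  rewrite Rintegral_cst; last exact: measurable_itv.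
  rewrite mulrC; congr (_ * _).
  exact: (congr1 fine (measure_seg0 (ltW T0))).
by rewrite /cintegral !E -Rcomplex_scaleE; case: c.
Qed.

Lemma FTC_affine (f F : R -> R) (l : R) :
  l != 0 -> continuous f -> (forall x : R, is_derive x 1 F (f x)) ->
  \int[lebesgue_measure]_(x in `[0, T]) f (l * x) = l^-1 * (F (l * T) - F 0).
Proof.
move=> l0 fc Ff; pose G x := l^-1 * F (l * x).
have dG (x : R) : is_derive x 1 G (f (l * x)).
  have := @is_deriveZ _ _ _ (F \o (fun x => l * x)) l^-1 x 1 (l * f (l * x)).
  rewrite (_ : l^-1 *: _ = f (l * x)); last by rewrite /GRing.scale/= mulKf.
  apply; have dl : is_derive x 1 (fun x : R => l * x) l.
    by have := @is_deriveZ _ _ _ id l x 1 1 _; rewrite /GRing.scale/= mulr1; apply.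
  have := @is_derive1_comp _ F (fun x : R => l * x) x _ _ (Ff _) dl.
  by rewrite mulrC.
have cG : continuous (G : R -> R).
  move=> x; apply: differentiable_continuous; apply/derivable1_diffP.
  by have [] := dG x.
rewrite /Rintegral (@continuous_FTC2 _ _ G)//.
- by rewrite /= /G mulr0 mulrBr.
- apply: continuous_subspaceT => x; apply: continuous_comp; last exact: fc.
  by apply: cvgM; [exact: cvg_cst|exact: cvg_id].
- split => [x _| |]; first by have [] := dG x.
  + exact/cvg_at_right_filter/cG.
  + exact/cvg_at_left_filter/cG.
- by move=> x _; rewrite derive1E; have [_] := dG x.
Qed.

(** For nonzero n the primitive takes the same value at 0 and at T. With T = L this is the
    orthogonality of the modes; with T = [tauP] it selects the resonant words. *)
Lemma cintegral_expi (n : int) :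
  cintegral `[0, T] (fun x => expi (2 * pi * n%:~R / T * x)) =
  if n == 0 then T%:C else 0.
Proof.
case: eqP => [->|/eqP n0].
  rewrite (_ : (fun x => _) = fun=> 1); first by rewrite cintegral_cst mulr1.
  by apply/funext => x; rewrite mulr0z mulr0 !mul0r expi0.
have l0 : 2 * pi * n%:~R / T != 0.
  by rewrite mulf_neq0 ?invr_neq0 ?(gt_eqF T0)// mulf_neq0 ?intr_eq0// gt_eqF ?mulr_gt0 ?pi_gt0.
rewrite /cintegral/= (FTC_affine l0 (@continuous_cos R) (fun x => is_derive_sin x)).
have dN (x : R) : is_derive x 1 (fun x => - cos x : R) (sin x).
  by have := is_deriveN (is_derive_cos x); rewrite opprK.
rewrite (FTC_affine l0 (@continuous_sin R) dN).
rewrite divfK ?gt_eqF// sin0 cos0.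
have /eqP := expi_2pi R n; rewrite eq_complex => /andP[/eqP cn /eqP sn].
rewrite /= in cn sn.
have z0 : 0 - 0 = 0 :> R by rewrite subrr.
have z1 : -1 - -1 = 0 :> R by rewrite subrr.
rewrite sn cn; apply/eqP; rewrite eq_complex /=.
rewrite [X in _ * X]z0 [X in _ && (_ * X == _)]z1 !mulr0 eqxx.
by [].
Qed.

End ExponentialIntegrals.

(** * Fourier coefficients and the Sobolev space *)

Section Coefficients.
Variables (R : realType) (L ell : R) (C : {posnum R}).
Hypothesis L0 : 0 < L.
Local Notation H := (Hper L ell C).
Local Notation wt := (fun K : int => (1 + K%:~R ^+ 2 : R) `^ ell).
Local Notation D := (`[0, L]%classic : set (measurableTypeR R)).

Definition cf (x : H) (K : int) : R[i] := fcoef L x K.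
Arguments cf : simpl never.

Lemma wt_ge0 K : 0 <= wt K. Proof. exact: powR_ge0. Qed.

Lemma normc_mode K x : normc (mode L K x) = 1. Proof. exact: normc_expi. Qed.

Lemma mode0 K : mode L K 0 = 1.
Proof. by rewrite /mode mulr0 mul0r expi0. Qed.

Lemma modeM J K x : mode L (J + K) x = mode L J x * mode L K x.
Proof.
by rewrite /mode -expiD intrD; congr expi; rewrite mulrDr !mulrDl.
Qed.

Lemma modeN K x : mode L (- K) x = ((mode L K x)^*)%R.
Proof. by rewrite /mode -expiN mulrNz mulrN !mulNr. Qed.

Lemma mode_linear J x : mode L J x = expi (2 * pi * J%:~R / L * x).
Proof. by rewrite /mode mulrAC. Qed.

Lemma ucont_mode J : ucont (mode L J).
Proof.
by rewrite (_ : mode L J = fun x => expi (2 * pi * J%:~R / L * x));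
  [exact: ucont_expi|apply/funext => x; exact: mode_linear].
Qed.

(** Termwise integration against a mode and orthogonality. An element of the space has to be the sum
    of its own Fourier series, so this is how elements are obtained from coefficients. *)
Lemma fcoef_series (c : int -> R[i]) B (f : R -> R[i]) : absum c B ->
  (forall x, csums (fun J => c J * mode L J x) (f x)) ->
  cintegrable D f /\ forall K, fcoef L f K = c K.
Proof.
move=> cB fc; have L00 := ltW L0.
split=> [|K].
  apply: ucont_integrable; apply: (ucont_series (phi := fun x J => mode L J x) cB _ ucont_mode) fc.
  by move=> x i; rewrite normc_mode.
have phiE x J : mode L J x * (mode L K x)^* = expi (2 * pi * (J - K)%:~R / L * x).
  by rewrite -modeN -modeM mode_linear.
have phi1 x J : normc (mode L J x * (mode L K x)^*) <= 1 by rewrite phiE normc_expi.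
have phiu J : ucont (fun x => mode L J x * (mode L K x)^*).
  by rewrite (_ : (fun _ => _) = fun x => expi (2 * pi * (J - K)%:~R / L * x));
    [exact: ucont_expi|apply/funext => x; exact: phiE].
have fK x : csums (fun J => c J * (mode L J x * (mode L K x)^*)) (f x * (mode L K x)^*).
  have := csumsZ (mode L K x)^* (fc x); rewrite mulrC; congr csums.
  by apply/funext => J; rewrite mulrC mulrA.
have intE J : c J * cintegral D (fun x => mode L J x * (mode L K x)^*) =
    if J == K then c J * L%:C else 0.
  rewrite (_ : (fun _ => _) =
    fun x => expi (2 * pi * (J - K)%:~R / L * x)); last by apply/funext => x; exact: phiE.
  by rewrite cintegral_expi// subr_eq0; case: ifP => // _; rewrite mulr0.
have := cintegral_series L00 cB phi1 phiu fK; under [in X in csums X]eq_fun do rewrite intE.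
move=> fI; have := csums_single (f := fun J => if J == K then c J * L%:C else 0) (j := K).
rewrite eqxx => KI; rewrite /fcoef (csums_unique fI (KI _)); last by move=> J /negbTE ->.
by rewrite mulrCA -rmorphM mulVf ?gt_eqF// rmorph1 mulr1.
Qed.

Lemma sobolev_sum_le (c : int -> R[i]) b :
  (sobolev_sum ell c <= b%:E)%E <->
  forall F : {fset int}, \sum_(K <- F) wt K * normc (c K) ^+ 2 <= b.
Proof.
split=> [cb F|cb].
  rewrite -lee_fin; apply: le_trans cb; apply: esum_ge; exists [set` F] => //.
  by rewrite fsbig_finite//= set_fsetK sumEFin.
apply: ge_ereal_sup => _ [A [Af _] <-]; rewrite fsbig_finite//= sumEFin lee_fin.
exact: cb.
Qed.

Lemma sobolev_sum_fin (c : int -> R[i]) b : (sobolev_sum ell c <= b%:E)%E ->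
  (sobolev_sum ell c < +oo)%E.
Proof. by move=> /le_lt_trans; apply; rewrite ltry. Qed.

Lemma cf_sobolev_fin (x : H) : (sobolev_sum ell (cf x) < +oo)%E.
Proof. by have [] := HfunS x. Qed.

Lemma Hnorm_le (x : H) m : 0 <= m ->
  (forall F : {fset int}, \sum_(K <- F) wt K * normc (cf x K) ^+ 2 <= m ^+ 2) ->
  `|x| <= C%:num * m.
Proof.
move=> m0 /sobolev_sum_le xm; rewrite Hper_normE ler_pM2l//.
rewrite -[m]ger0_norm// -sqrtr_sqr ler_wsqrtr//.
by rewrite -[leRHS]/(fine (m ^+ 2)%:E) fine_le// ge0_fin_numE ?sobolev_sum_ge0//
  (sobolev_sum_fin xm).
Qed.

Lemma Hnorm_ge (x : H) (F : {fset int}) :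
  \sum_(K <- F) wt K * normc (cf x K) ^+ 2 <= (`|x| / C%:num) ^+ 2.
Proof.
move: F; apply/sobolev_sum_le; rewrite Hper_normE mulrAC divff ?mul1r//.
rewrite sqr_sqrtr ?fine_ge0 ?sobolev_sum_ge0// fineK//.
by rewrite ge0_fin_numE ?sobolev_sum_ge0// cf_sobolev_fin.
Qed.

Lemma Hper_csums (x : H) t : csums (fun K => cf x K * mode L K t) (x t).
Proof. by have [_ _ /(_ t) /has_csumTP] := HfunS x. Qed.

Lemma Happ_inj (x y : H) : x = y :> (R -> R[i]) -> x = y.
Proof. by move=> xy; apply: val_inj. Qed.

Lemma cf_inj (x y : H) : (forall K, cf x K = cf y K) -> x = y.
Proof.
move=> xy; apply: Happ_inj; apply/funext => t; apply: csums_unique (Hper_csums x t) _.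
by under eq_fun do rewrite xy; exact: Hper_csums.
Qed.

Lemma cfD (x y : H) K : cf (x + y) K = cf x K + cf y K.
Proof.
have [xi _ _] := HfunS x; have [yi _ _] := HfunS y.
by rewrite /cf HappD fcoefD.
Qed.

Lemma cfZ (a : R) (x : H) K : cf (a *: x) K = a%:C * cf x K.
Proof. by have [xi _ _] := HfunS x; rewrite /cf HappZ fcoefZ. Qed.

Lemma cf0 K : cf 0 K = 0.
Proof. exact: fcoef0. Qed.

Lemma cfB (x y : H) K : cf (x - y) K = cf x K - cf y K.
Proof. by rewrite cfD -scaleN1r cfZ rmorphN rmorph1 mulN1r. Qed.

Lemma cf_sum (I : Type) (r : seq I) (f : I -> H) K :
  cf (\sum_(i <- r) f i) K = \sum_(i <- r) cf (f i) K.
Proof.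
elim: r => [|i r IH]; first by rewrite !big_nil cf0.
by rewrite !big_cons cfD IH.
Qed.

Lemma Happ_sum (I : Type) (r : seq I) (f : I -> H) t :
  Happ (\sum_(i <- r) f i) t = \sum_(i <- r) Happ (f i) t.
Proof.
elim: r => [|i r IH]; first by rewrite !big_nil.
by rewrite !big_cons HappD IH.
Qed.

(** Absolute summability is assumed besides the Sobolev bound: deriving it from that bound, in
    [sobolev_absum], uses trigonometric polynomials, which are themselves built from the modes given
    by this lemma. *)
Lemma ex_Hper (c : int -> R[i]) B b : absum c B -> (sobolev_sum ell c <= b%:E)%E ->
  exists x : H, forall K, cf x K = c K.
Proof.
move=> cB cb.
have fE t : csums (fun K => c K * mode L K t) (fseries L c t).
  have : absum (fun K => c K * mode L K t) B.
    by apply: absumM => // K; rewrite normc_mode.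
  by move=> /absum_csums[s cs]; rewrite /fseries (has_csumE (s := s)) ?has_csumTP.
have [fi fc] := fcoef_series cB fE.
have fcE : fcoef L (fseries L c) = c by apply/funext.
have fH : in_Hper L ell (fseries L c).
  by split => [//||t]; rewrite fcE; [exact: sobolev_sum_fin cb|exact/has_csumTP].
by exists (@MkHper R L ell C (fseries L c) (mem_set fH)) => K; exact: fc.
Qed.

Lemma ex_Emode J : exists x : H, x = mode L J :> (R -> R[i]) /\
  forall K, cf x K = if K == J then 1 else 0.
Proof.
pose c K : R[i] := if K == J then 1 else 0.
have c1 : absum c 1.
  move=> F; apply: le_trans (ler_sum_supp (s := [:: J]) (fset_uniq F) _ _) _.
  - by move=> K; exact: normc_ge0.
  - by move=> K _; rewrite inE => /negbTE KJ; rewrite /c KJ ComplexField.Normc.normc0.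
  - by rewrite big_seq1 /c eqxx ComplexField.Normc.normc1.
have cS : (sobolev_sum ell c <= (wt J)%:E)%E.
  apply/sobolev_sum_le => F.
  apply: le_trans (ler_sum_supp (s := [:: J]) (fset_uniq F) _ _) _.
  - by move=> K; rewrite mulr_ge0 ?wt_ge0 ?sqr_ge0.
  - move=> K _; rewrite inE => /negbTE KJ.
    by rewrite /c KJ ComplexField.Normc.normc0 expr0n mulr0.
  - by rewrite big_seq1 /c eqxx ComplexField.Normc.normc1 expr1n mulr1.
have [x xc] := ex_Hper c1 cS; exists x; split => //; apply/funext => t.
apply: csums_unique (Hper_csums x t) _; under eq_fun do rewrite xc.
have := csums_single (f := fun K => c K * mode L K t) (j := J).
by rewrite /c eqxx mul1r; apply => K /negbTE ->; rewrite mul0r.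
Qed.

Definition Emode J : H := projT1 (cid (ex_Emode J)).

Lemma EmodeE J : Emode J = mode L J :> (R -> R[i]).
Proof. by rewrite /Emode; case: cid => x []. Qed.

Lemma cf_Emode J K : cf (Emode J) K = if K == J then 1 else 0.
Proof. by rewrite /Emode; case: cid => x []. Qed.

(** Several indices may share a frequency, so that sums over words with [k] = [wfreq] are of this
    form. *)
Definition trig (I : Type) (r : seq I) (p : I -> R) (k : I -> int) : H :=
  \sum_(i <- r) p i *: Emode (k i).

Lemma trigE (I : Type) (r : seq I) (p : I -> R) (k : I -> int) t :
  trig r p k t = \sum_(i <- r) (p i)%:C * mode L (k i) t.
Proof. by rewrite /trig Happ_sum; apply: eq_bigr => i _; rewrite HappZ EmodeE. Qed.

Lemma cf_trig (I : Type) (r : seq I) (p : I -> R) (k : I -> int) K :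
  cf (trig r p k) K = (\sum_(i <- r | k i == K) p i)%:C.
Proof.
rewrite /trig cf_sum rmorph_sum/= [RHS]big_mkcond/=; apply: eq_bigr => i _.
by rewrite cfZ cf_Emode eq_sym; case: ifP; rewrite ?mulr1 ?mulr0.
Qed.

End Coefficients.

Arguments cf : simpl never.

(** The point 0 lies outside the open interval of the norm. If the modulus exceeded m at 0, it would
    exceed m on an interval to the right of 0, which has positive measure. *)
Lemma Linfty_norm_at0 (R : realType) (L m : R) (f : R -> R[i]) : 0 < L -> ucont f ->
  (Linfty_norm L f <= m%:E)%E -> normc (f 0) <= m.
Proof.
move=> L0 fu /ess_supP [A [mA A0 sA]]; rewrite leNgt; apply/negP => mf.
have e0 : 0 < (normc (f 0) - m) / 2 by rewrite divr_gt0// subr_gt0.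
have [d d0 fd] := fu _ e0.
have r0 : 0 < Num.min d L by rewrite lt_min d0.
have : (lebesgue_measure (`]0%R, (Num.min d L)[%classic : set (measurableTypeR R)) <= 0)%E.
  rewrite -A0; apply: le_measure; rewrite ?inE; [exact: measurable_itv|exact: mA|].
  apply: subset_trans sA => t /=; rewrite in_itv/= lt_min => /and3P[t0 td tL].
  rewrite patchE ifT ?inE/= ?in_itv/= ?t0//; apply/negP; rewrite -ltNge lte_fin.
  have /fd : `|0 - t| < d by rewrite sub0r normrN gtr0_norm.
  have := le_normcD (f 0 - f t) (f t); rewrite subrK; lra.
by rewrite lebesgue_measure_itv/= lte_fin r0 sube0 lee_fin leNgt r0.
Qed.

(** * The embedding of the Sobolev space into l^1 *)

Section Embedding.
Variables (R : realType) (L ell : R) (C : {posnum R}).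
Hypotheses (L0 : 0 < L) (hC : Hconst_admissible L ell C).
Local Notation H := (Hper L ell C).
Local Notation wt := (fun K : int => (1 + K%:~R ^+ 2 : R) `^ ell).
Local Notation trig := (trig ell C L0).

(** All modes equal 1 at 0, so the value there is the sum of the coefficients. *)
Lemma trig_sum_le (I : Type) (r : seq I) (p : I -> R) k :
  (forall i, 0 <= p i) -> \sum_(i <- r) p i <= `|trig r p k|.
Proof.
move=> p0; have [_ /(_ (trig r p k))] := hC.
move=> /(Linfty_norm_at0 L0); rewrite trigE.
have -> : \sum_(i <- r) (p i)%:C * mode L (k i) 0 = (\sum_(i <- r) p i)%:C.
  by rewrite rmorph_sum; apply: eq_bigr => i _; rewrite mode0 mulr1.
rewrite normc_real ger0_norm ?sumr_ge0//; apply.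
rewrite (_ : Happ _ = fun t => \sum_(i <- r) (p i)%:C * mode L (k i) t).
  by apply: ucont_sum => i; apply: ucontZ; exact: ucont_mode.
by apply/funext => t; rewrite trigE.
Qed.

(** The map [s] is the identity or the opposite in the applications, the latter for conjugate
    factors. It preserves the weights and, as [J] has no repetition, each frequency is reached at
    most once. *)
Lemma trig_norm_le (J : seq int) (s : int -> int) (p : int -> R) (c : int -> R[i]) m :
  uniq J -> involutive s -> (forall K, (s K)%:~R ^+ 2 = K%:~R ^+ 2 :> R) ->
  (forall K, 0 <= p K <= normc (c K)) -> 0 <= m ->
  (sobolev_sum ell c <= (m ^+ 2)%:E)%E -> `|trig J p s| <= C%:num * m.
Proof.
move=> uJ sK s2 pc m0 /sobolev_sum_le cm; apply: Hnorm_le => // F.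
apply: le_trans (cm [fset s K | K in F]%fset).
rewrite [leRHS](perm_big [seq s K | K <- F])/=; last first.
  apply: uniq_perm; [exact: fset_uniq|by rewrite map_inj_uniq ?fset_uniq//; exact: inv_inj sK|].
  move=> K; rewrite -[LHS]/(K \in [fset s K | K in F]%fset).
  apply/imfsetP/mapP => [[K' /= KF ->]|[K' KF ->]]; by exists K'.
rewrite big_map; apply: ler_sum => K _; rewrite s2 ler_wpM2l ?wt_ge0//.
have /andP[pK0 pK] := pc (s K).
rewrite ler_sqr ?nnegrE ?normc_ge0//.
rewrite cf_trig normc_real ger0_norm; last by apply: sumr_ge0 => i _; have /andP[] := pc i.
apply: le_trans pK.
rewrite (eq_bigl (pred1 (s K))); last by move=> i /=; rewrite -(inj_eq (inv_inj sK)) sK.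
rewrite -big_filter; apply: le_trans (ler_sum_sub (s := [:: s K]) _ _ _) _.
- exact: filter_uniq.
- by move=> i; have /andP[] := pc i.
- by move=> i; rewrite mem_filter mem_seq1 => /andP[].
- by rewrite big_seq1.
Qed.

Lemma sobolev_absum (c : int -> R[i]) m : 0 <= m ->
  (sobolev_sum ell c <= (m ^+ 2)%:E)%E -> absum c (C%:num * m).
Proof.
move=> m0 cm F.
apply: le_trans (trig_sum_le (enum_fset F) id _) _; first by move=> i; exact: normc_ge0.
apply: (trig_norm_le (c := c)) => //; first exact: fset_uniq.
by move=> K; rewrite normc_ge0 lexx.
Qed.

Lemma Hper_sobolev_le (x : H) : (sobolev_sum ell (cf x) <= ((`|x| / C%:num) ^+ 2)%:E)%E.
Proof. by apply/sobolev_sum_le => F; exact: Hnorm_ge. Qed.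

(** The constant C of the norm cancels. The bound without a constant is what keeps pointwise values
    inside the disc of convergence. *)
Lemma cf_absum (x : H) : absum (cf x) `|x|.
Proof.
rewrite -[X in absum _ X](divfK (_ : C%:num != 0))// mulrC.
by apply: sobolev_absum; [exact: divr_ge0|exact: Hper_sobolev_le].
Qed.

Lemma ex_Hper_sobolev (c : int -> R[i]) m : 0 <= m ->
  (sobolev_sum ell c <= (m ^+ 2)%:E)%E -> exists x : H, forall K, cf x K = c K.
Proof. by move=> m0 cm; exact: (ex_Hper C L0 (sobolev_absum m0 cm) cm). Qed.

End Embedding.

(** * Words of frequencies and the majorant *)

Section Words.

Fixpoint words (J : seq int) (a : nat) : seq (seq int) :=
  if a is a'.+1 then [seq x :: w | x <- J, w <- words J a'] else [:: [::]].

Lemma mem_words J (w : seq int) : {subset w <= J} -> w \in words J (size w).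
Proof.
elim: w => [//|x w IH] xwJ /=; apply/allpairsP; exists (x, w); split => //=.
  by apply: xwJ; rewrite inE eqxx.
by apply: IH => y yw; apply: xwJ; rewrite inE yw orbT.
Qed.

Lemma size_words J a w : w \in words J a -> size w = a.
Proof.
elim: a w => [|a IH] w /=; first by rewrite inE => /eqP ->.
by move=> /allpairsP[[x v] [_ /= /IH va ->]] /=; rewrite va.
Qed.

Lemma sum_words (S : comNzRingType) (J : seq int) a (f : int -> S) :
  \sum_(w <- words J a) \prod_(x <- w) f x = (\sum_(x <- J) f x) ^+ a.
Proof.
elim: a => [|a IH]; first by rewrite big_seq1 big_nil expr0.
rewrite [words _ _]/= big_allpairs_dep/= exprS -IH big_distrl/=.
apply: eq_bigr => x _; rewrite big_distrr/=; apply: eq_bigr => w _.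
by rewrite big_cons.
Qed.

(* A pair of words (j, k) of lengths a and b indexes the monomial
   \prod u_(j_m) \prod (u_(k_m))^* of the expansion of u^a (u^* )^b. *)
Definition windex := (seq int * seq int)%type.

Definition words2 (J : seq int) (ab : nat * nat) : seq windex :=
  [seq (j, k) | j <- words J ab.1, k <- words J ab.2].

Definition wsize (i : windex) : nat * nat := (size i.1, size i.2).

Definition wfreq (i : windex) : int := \sum_(x <- i.1) x - \sum_(x <- i.2) x.

(** The free flow multiplies the monomial of [i] by a phase proportional to [wquad i]; resonance at
    K means [wfreq i] = K and [wquad i] = K^2. *)
Definition wquad (i : windex) : int :=
  \sum_(x <- i.1) x ^+ 2 - \sum_(x <- i.2) x ^+ 2.

Lemma size_words2 J ab i : i \in words2 J ab -> wsize i = ab.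
Proof.
case: ab => a b /allpairsP[[j k] [/= /size_words ja /size_words kb ->]].
by rewrite /wsize /= ja kb.
Qed.

Lemma mem_words2 J (i : windex) : {subset i.1 ++ i.2 <= J} -> i \in words2 J (wsize i).
Proof.
case: i => j k /= jkJ; apply/allpairsP; exists (j, k).
by split => //=; apply: mem_words => x xi; apply: jkJ; rewrite mem_cat xi ?orbT.
Qed.

End Words.

Section Monomials.
Variable R : realType.
Implicit Types c : int -> R[i].

Definition monomial c (i : windex) : R[i] :=
  \prod_(x <- i.1) c x * \prod_(x <- i.2) (c x)^*.

Definition wprod (p : int -> R) (i : windex) : R :=
  \prod_(x <- i.1) p x * \prod_(x <- i.2) p x.

Lemma normc_monomial c i : normc (monomial c i) = wprod (fun K => normc (c K)) i.
Proof.
rewrite ComplexField.Normc.normcM !normc_prod; congr (_ * _).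
by apply: eq_bigr => x _; rewrite normc_conj.
Qed.

Lemma monomialM c c' i :
  monomial (fun K => c K * c' K) i = monomial c i * monomial c' i.
Proof.
rewrite /monomial big_split/= mulrACA -[X in _ = _ * X]big_split/=; congr (_ * _).
by apply: eq_bigr => x _; rewrite rmorphM.
Qed.

Lemma monomial_expi (a : int -> R) i :
  monomial (fun K => expi (a K)) i = expi (\sum_(x <- i.1) a x - \sum_(x <- i.2) a x).
Proof.
have prodE (r : seq int) (b : int -> R) :
    \prod_(x <- r) expi (b x) = expi (\sum_(x <- r) b x).
  by elim: r => [|x r IH]; rewrite ?big_nil ?expi0// !big_cons expiD IH.
rewrite expiD -sumrN -!prodE; congr (_ * _).
by apply: eq_bigr => x _; rewrite expiN.
Qed.

Lemma monomial_mode L t i : monomial (fun K => mode L K t) i = mode L (wfreq i) t.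
Proof.
rewrite [LHS]monomial_expi mode_linear; congr expi; rewrite /wfreq rmorphB !rmorph_sum/=.
rewrite mulrBr !mulrBl !mulr_sumr !mulr_suml.
by congr (_ - _); apply: eq_bigr => x _; rewrite mulrAC.
Qed.

End Monomials.

Section Majorant.
Variables (R : realType) (L ell : R) (C : {posnum R}).
Hypotheses (L0 : 0 < L) (hC : Hconst_admissible L ell C).
Local Notation H := (Hper L ell C).
Local Notation wt := (fun K : int => (1 + K%:~R ^+ 2 : R) `^ ell).
Local Notation tpoly := (trig ell C L0).
Variables (alpha : nat -> nat -> R[i]) (u : H).
Variable A : R.
Hypothesis alphaA : forall B : seq (nat * nat), uniq B ->
  (forall ab, ab \in B -> (2 <= ab.1 + ab.2)%N) ->
  \sum_(ab <- B) normc (alpha ab.1 ab.2) * `|u| ^+ (ab.1 + ab.2) <= A.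
Let p K := normc (cf u K).

(** The values of [alpha] at exponents with a + b < 2 are arbitrary; they are replaced by 0 so that
    all words can be used as indices. *)
Definition wcoef (i : windex) : R[i] :=
  if (2 <= size i.1 + size i.2)%N then alpha (size i.1) (size i.2) else 0.

Definition wterm (i : windex) : R[i] := wcoef i * monomial (cf u) i.

(** Expanding a product of sums gives all words over the alphabet [J]. Read backwards, the
    polynomial over these words is a product to which submultiplicativity applies. *)
Lemma trig_words2E J ab t :
  tpoly (words2 J ab) (wprod p) wfreq t =
  (\sum_(K <- J) (p K)%:C * mode L K t) ^+ ab.1 *
  (\sum_(K <- J) (p K)%:C * mode L (- K) t) ^+ ab.2.
Proof.
rewrite trigE -!sum_words big_distrlr/= big_allpairs_dep/=.
apply: eq_bigr => j _; apply: eq_bigr => k _.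
rewrite -monomial_mode /wprod rmorphM/= !rmorph_prod/= mulrACA -!big_split/=.
by congr (_ * _); apply: eq_bigr => x _; rewrite modeN.
Qed.

Lemma norm_trig_le J s : uniq J -> involutive s ->
  (forall K, (s K)%:~R ^+ 2 = K%:~R ^+ 2 :> R) -> `|tpoly J p s| <= `|u|.
Proof.
move=> uJ sK s2; rewrite -[leRHS](divfK (_ : C%:num != 0))// mulrC.
apply: (trig_norm_le C L0 (c := cf u)) => //.
- by move=> K; rewrite /p normc_ge0 lexx.
- exact: Hper_sobolev_le.
Qed.

(** The factors are multiplied one at a time, each partial product being a polynomial already in the
    space. The empty product is the constant 1, whose norm remains as an extra factor. *)
Lemma norm_trig_words2 J ab : uniq J ->
  `|tpoly (words2 J ab) (wprod p) wfreq| <=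
  `|u| ^+ (ab.1 + ab.2) * `|tpoly [:: ([::], [::])] (wprod p) wfreq|.
Proof.
move=> uJ; set N0 := `|tpoly [:: _] _ _|.
have step k (X Y : H) n : involutive k -> (forall K, (k K)%:~R ^+ 2 = K%:~R ^+ 2 :> R) ->
    (forall t, Y t = tpoly J p k t * X t) -> `|X| <= `|u| ^+ n * N0 ->
    `|Y| <= `|u| ^+ n.+1 * N0.
  move=> kK k2 YX Xn; rewrite exprS -mulrA; apply: le_trans (hC.1 _ _ _ YX) _.
  by apply: ler_pM => //; exact: norm_trig_le.
case: ab => a b; rewrite [(a, b).1]/= [(a, b).2]/=; elim: a => [|a IH].
  rewrite add0n; elim: b => [|b IH]; first by rewrite expr0 mul1r.
  apply: (step -%R) IH => [|K|t]; [exact: opprK|by rewrite rmorphN sqrrN|].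
  by rewrite !trig_words2E trigE [(0, _).2]/= exprS mulrCA.
apply: (step id) IH => // t.
by rewrite !trig_words2E trigE [(_, b).1]/= exprS mulrA.
Qed.

Let A' := A * `|tpoly [:: ([::], [::])] (wprod p) wfreq|.

(** A finite set of words is enlarged to all words over its letters with its pairs of lengths. The
    enlarged set factors, and its norm is bounded independently of [F]; words of total length below
    2 may be dropped, as their terms vanish. *)
Lemma trig_cover (F : {fset windex}) : exists2 W : seq windex,
  (forall i, i \in F -> i \notin W -> wterm i = 0) &
  `|tpoly W (fun i => normc (wterm i)) wfreq| <= A'.
Proof.
pose J := undup (flatten [seq i.1 ++ i.2 | i <- F]).
pose B := [seq ab <- undup [seq wsize i | i <- F] | (2 <= ab.1 + ab.2)%N].
exists (flatten [seq words2 J ab | ab <- B]) => [i iF|].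
  apply: contraNeq => Ti; apply/flattenP; exists (words2 J (wsize i)).
    apply: map_f; rewrite mem_filter mem_undup map_f// andbT.
    by move: Ti; rewrite /wterm /wcoef; case: ifP => //; rewrite mul0r eqxx.
  apply: mem_words2 => x xi; rewrite mem_undup; apply/flattenP.
  by exists (i.1 ++ i.2) => //; exact: map_f.
have -> : tpoly (flatten [seq words2 J ab | ab <- B]) (fun i => normc (wterm i)) wfreq =
    \sum_(ab <- B) normc (alpha ab.1 ab.2) *: tpoly (words2 J ab) (wprod p) wfreq.
  rewrite /trig big_flatten big_map; apply: eq_big_seq => ab abB.
  rewrite scaler_sumr; apply: eq_big_seq => i /size_words2 iab.
  rewrite scalerA ComplexField.Normc.normcM normc_monomial; congr (normc _ * _ *: _).
  by move: abB; rewrite mem_filter -iab /wcoef /= => /andP[->].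
apply: le_trans (ler_norm_sum _ _ _) _.
under eq_bigr do rewrite normrZ (ger0_norm (normc_ge0 _)).
apply: le_trans (ler_sum _ (fun ab _ =>
  ler_wpM2l (normc_ge0 _) (norm_trig_words2 ab (undup_uniq _)))) _.
under eq_bigr do rewrite mulrA.
rewrite -mulr_suml ler_wpM2r//; apply: alphaA; first by rewrite filter_uniq// undup_uniq.
by move=> ab; rewrite mem_filter => /andP[].
Qed.

Lemma wterm_absum : absum wterm A'.
Proof.
move=> F; have [W W0 WA] := trig_cover F.
apply: le_trans WA; apply: (@le_trans _ _ (\sum_(i <- W) normc (wterm i))).
  apply: (ler_sum_supp (p := fun i => normc (wterm i))) => //.
  - by move=> i; exact: normc_ge0.
  - by move=> i iF iW; rewrite (W0 _ iF iW) ComplexField.Normc.normc0.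
apply: (@trig_sum_le _ _ _ _ L0 hC _ W (fun i => normc (wterm i)) wfreq) => i.
exact: normc_ge0.
Qed.

Let A'_ge0 : 0 <= A'. Proof. exact: absum_ge0 wterm_absum. Qed.

(** The fibre sums over a cover of [F] are the Fourier coefficients of a polynomial of norm at most
    [A']. *)
Lemma fiber_sums_le (F : {fset windex}) (G : {fset int}) :
  \sum_(K <- G) wt K *
    (\sum_(i <- F) (if wfreq i == K then normc (wterm i) else 0)) ^+ 2 <=
  (A' / C%:num) ^+ 2.
Proof.
have [W W0 WA] := trig_cover F.
apply: (@le_trans _ _ ((`|tpoly W (fun i => normc (wterm i)) wfreq| / C%:num) ^+ 2)); last first.
  by rewrite ler_sqr ?nnegrE ?divr_ge0// ler_wpM2r// invr_ge0.
apply: le_trans (Hnorm_ge _ G); apply: ler_sum => K _.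
rewrite ler_wpM2l ?wt_ge0// cf_trig normc_real.
have fib0 i : 0 <= (if wfreq i == K then normc (wterm i) else 0).
  by case: ifP => // _; exact: normc_ge0.
rewrite [X in `|X|]big_mkcond/= ler_sqr ?nnegrE ?sumr_ge0// ger0_norm ?sumr_ge0//.
apply: (ler_sum_supp (p := fun i => if wfreq i == K then normc (wterm i) else 0)) => // i iF iW.
by rewrite (W0 _ iF iW) ComplexField.Normc.normc0 if_same.
Qed.

(** [M K] is the supremum of the finite fibre sums. Different K approach it along different finite
    sets, while [fiber_sums_le] concerns one set: for finite [G] a common set is chosen that is good
    up to e, and then e tends to 0. *)
Lemma ex_majorant : exists M : int -> R,
  (forall K (F : {fset windex}),
     \sum_(i <- F) (if wfreq i == K then normc (wterm i) else 0) <= M K) /\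
  (sobolev_sum ell (fun K => (M K)%:C) <= ((A' / C%:num) ^+ 2)%:E)%E.
Proof.
pose q K i := if wfreq i == K then normc (wterm i) else 0.
have q0 K i : 0 <= q K i by rewrite /q; case: ifP => // _; exact: normc_ge0.
have exM K : exists m : R, (forall F : {fset windex}, \sum_(i <- F) q K i <= m) /\
    forall e, 0 < e -> exists F0 : {fset windex}, m - e <= \sum_(i <- F0) q K i.
  apply: (nonneg_sums_cvg (B := A') (q0 K)) => F; apply: le_trans (wterm_absum F).
  by apply: ler_sum => i _; rewrite /q; case: ifP => // _; exact: normc_ge0.
have [M MP] := choice exM; exists M; split=> [K F|]; first by have [+ _] := MP K; apply.
have M0 K : 0 <= M K by have [/(_ fset0)] := MP K; rewrite big_seq_fset0.
apply/sobolev_sum_le => G; set b := (_ ^+ 2).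
have cover e : 0 < e -> exists F : {fset windex}, forall K, K \in G ->
    M K <= \sum_(i <- F) q K i + e.
  move=> e0; have : forall s : seq int, exists F : {fset windex}, forall K, K \in s ->
      M K <= \sum_(i <- F) q K i + e.
    elim=> [|K s [F FK]]; first by exists fset0.
    have [_ /(_ _ e0) [F' F'K]] := MP K; exists (F `|` F')%fset => K'.
    rewrite inE => /predU1P[->|K's].
      rewrite -lerBlDr; apply: le_trans F'K _; apply: ler_sum_sub => //.
      by move=> i iF; rewrite inE iF orbT.
    apply: le_trans (FK _ K's) _; rewrite lerD2r; apply: ler_sum_sub => //.
    by move=> i iF; rewrite inE iF.
  by move=> /(_ (enum_fset G)).
have b0 : 0 <= b by exact: sqr_ge0.
pose V : R := \sum_(K <- G) wt K.
have V0 : 0 <= V by apply: sumr_ge0 => K _; exact: wt_ge0.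
have step e : 0 < e -> e <= 1 ->
    \sum_(K <- G) wt K * normc (M K)%:C ^+ 2 <= b + e * (b + 2 * V).
  move=> e0 e1; have [F FG] := cover _ e0.
  apply: (@le_trans _ _ (\sum_(K <- G)
      ((1 + e) * (wt K * (\sum_(i <- F) q K i) ^+ 2) + e * 2 * wt K))).
    rewrite !big_seq; apply: ler_sum => K KG; rewrite normc_real ger0_norm//.
    have MF := FG _ KG; set y := \sum_(i <- F) _ in MF *.
    have y0 : 0 <= y by exact: sumr_ge0.
    rewrite [leRHS](_ : _ = wt K * ((1 + e) * y ^+ 2 + e * 2)); last by ring.
    rewrite ler_wpM2l ?wt_ge0//; have MK0 := M0 K.
    apply: (@le_trans _ _ ((y + e) ^+ 2)); first by rewrite ler_sqr ?nnegrE// addr_ge0// ltW.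
    (* The inequality (y + e)^2 <= (1 + e) y^2 + 2 e holds for 0 <= e <= 1 because the difference is
       this product. *)
    rewrite sqrrD -subr_ge0 [X in 0 <= X](_ : _ = e * ((y - 1) ^+ 2 + (1 - e))); last by ring.
    by rewrite mulr_ge0 ?(ltW e0)// addr_ge0 ?sqr_ge0// subr_ge0.
  rewrite big_split/= -!mulr_sumr.
  apply: (@le_trans _ _ ((1 + e) * b + e * 2 * V)); last first.
    by rewrite le_eqVlt; apply/orP; left; apply/eqP; ring.
  rewrite lerD2r ler_wpM2l ?addr_ge0 ?(ltW e0)//; exact: fiber_sums_le.
apply/ler_addgt0Pr => e e0.
have w0 : 0 <= b + 2 * V by rewrite addr_ge0// mulr_ge0.
have v0 : 0 < b + 2 * V + 1 by rewrite ltr_wpDl.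
pose m := Num.min 1 (e / (b + 2 * V + 1)).
have m0 : 0 < m by rewrite lt_min ltr01 divr_gt0.
apply: le_trans (step m m0 _) _; first by rewrite ge_min lexx.
rewrite lerD2l; apply: (@le_trans _ _ (e / (b + 2 * V + 1) * (b + 2 * V + 1))).
  apply: ler_pM (ltW m0) w0 _ _; last by rewrite lerDl.
  by rewrite ge_min lexx orbT.
by rewrite divfK// gt_eqF.
Qed.

End Majorant.

(** * Domination and Bochner integrals *)

Section Domination.
Variables (R : realType) (L ell : R) (C : {posnum R}).
Local Notation H := (Hper L ell C).
Local Notation wt := (fun K : int => (1 + K%:~R ^+ 2 : R) `^ ell).
Variables (M : int -> R) (b : R).
Hypotheses (M0 : forall K, 0 <= M K).
Hypothesis Mb : (sobolev_sum ell (fun K => (M K)%:C) <= b%:E)%E.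

(* Dominated convergence in the Sobolev norm: below a summable majorant, finitely
   many Fourier coefficients control the norm. *)
Lemma dominated_Hnorm e : 0 < e -> exists (G : {fset int}) (d : R), 0 < d /\
  forall x : H, (forall K, normc (cf x K) <= M K) ->
    (forall K, K \in G -> normc (cf x K) <= d) -> `|x| <= e.
Proof.
move=> e0; pose g := e / C%:num; have g0 : 0 < g by rewrite divr_gt0.
have h0 : 0 < g ^+ 2 / 2 by rewrite divr_gt0// exprn_gt0.
have q0 K : 0 <= wt K * M K ^+ 2 by rewrite mulr_ge0 ?wt_ge0 ?sqr_ge0.
have qb : absum (fun K => (wt K * M K ^+ 2)%:C) b.
  apply: absum_real => // F; move/sobolev_sum_le: Mb => /(_ F); congr (_ <= _).
  by apply: eq_bigr => K _; rewrite normc_real ger0_norm.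
have [G Gh] := absum_tail qb h0.
pose V : R := \sum_(K <- G) wt K.
have V0 : 0 <= V by apply: sumr_ge0 => K _; exact: wt_ge0.
have V1 : 0 < V + 1 by rewrite ltr_wpDl.
(* As d is at most 1, a coefficient of modulus at most d has its square at most d; the second bound
   then leaves at most half of g^2 for the frequencies in [G]. *)
pose d := Num.min 1 (g ^+ 2 / 2 / (V + 1)).
have d0 : 0 < d by rewrite lt_min ltr01 divr_gt0.
exists G, d; split=> // x xM xG.
rewrite (_ : e = C%:num * g); last by rewrite /g mulrC divfK.
apply: Hnorm_le => [|F]; first exact: ltW.
rewrite [leRHS]splitr (bigID (mem G))/=; apply: lerD.
  apply: (@le_trans _ _ (\sum_(K <- G) wt K * d)).
    rewrite -big_filter; apply: (@le_trans _ _ (\sum_(K <- [seq K <- F | K \in G]) wt K * d)).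
      rewrite !big_seq; apply: ler_sum => K; rewrite mem_filter => /andP[KG _].
      rewrite ler_wpM2l ?wt_ge0// expr2 -[leRHS]mulr1.
      have Kd := xG _ KG; apply: ler_pM; rewrite ?normc_ge0//.
      by apply: le_trans Kd _; rewrite ge_min lexx.
    apply: ler_sum_sub => [|K|K]; first by rewrite filter_uniq// fset_uniq.
      by rewrite mulr_ge0 ?wt_ge0 ?(ltW d0).
    by rewrite mem_filter => /andP[].
  rewrite -mulr_suml -/V; apply: (@le_trans _ _ ((V + 1) * (g ^+ 2 / 2 / (V + 1)))).
    apply: ler_pM; rewrite ?(ltW d0)//; first by rewrite lerDl.
    by rewrite ge_min lexx orbT.
  by rewrite mulrC divfK// gt_eqF.
rewrite big_fset_condE/=.
rewrite (_ : [fset i | i in F & i \notin G]%fset = (F `\` G)%fset); last first.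
  by apply/fsetP => i; rewrite !inE andbC.
apply: le_trans _ (Gh (F `\` G)%fset _); last by apply/fdisjointP => K KG; rewrite inE KG.
apply: ler_sum => K _; rewrite normc_real ger0_norm// ler_wpM2l ?wt_ge0//.
by rewrite ler_sqr ?nnegrE ?normc_ge0.
Qed.

End Domination.

Section UniformContinuityH.
Variables (R : realType) (L ell : R) (C : {posnum R}).
Local Notation H := (Hper L ell C).

Lemma sobolev_sum_scale (a b : R) (M : int -> R) :
  (sobolev_sum ell (fun K => (M K)%:C) <= b%:E)%E ->
  (sobolev_sum ell (fun K => (a * M K)%:C) <= (a ^+ 2 * b)%:E)%E.
Proof.
move=> Mb; have aM K : (a * M K)%:C = a%:C * (M K)%:C :> R[i] by rewrite rmorphM.
apply: le_trans (@sobolev_sumZ R ell a (fun K => (M K)%:C) _ aM) _.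
by rewrite [leRHS]EFinM; apply: lee_wpmul2l => //; rewrite lee_fin sqr_ge0.
Qed.

Definition ucont_in (P : set R) (X : normedModType R) (h : R -> X) :=
  forall e : R, 0 < e -> exists2 d : R, 0 < d &
    forall x y, P x -> P y -> `|x - y| < d -> `|h x - h y| <= e.

(** Differences of values are dominated by 2 M, so [dominated_Hnorm] leaves finitely many
    coefficients, with a common modulus of continuity. *)
Lemma ucont_in_Hper (P : set R) (h : R -> H) (M : int -> R) b :
  (forall s, P s -> forall K, normc (cf (h s) K) <= M K) ->
  (sobolev_sum ell (fun K => (M K)%:C) <= b%:E)%E -> (forall K, 0 <= M K) ->
  (forall K e, 0 < e -> exists2 d : R, 0 < d &
    forall x y, P x -> P y -> `|x - y| < d -> normc (cf (h x) K - cf (h y) K) <= e) ->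
  ucont_in P h.
Proof.
move=> hM /(sobolev_sum_scale 2) Mb M0 hu e e0.
have M20 K : 0 <= 2 * M K by rewrite mulr_ge0.
have [G [d [d0 Gd]]] := dominated_Hnorm L C M20 Mb e0.
have [d' d'0 Gu] : exists2 d' : R, 0 < d' & forall K, K \in G -> forall x y, P x -> P y ->
    `|x - y| < d' -> normc (cf (h x) K - cf (h y) K) <= d.
  have : forall s : seq int, exists2 d' : R, 0 < d' & forall K, K \in s ->
      forall x y, P x -> P y -> `|x - y| < d' -> normc (cf (h x) K - cf (h y) K) <= d.
    elim=> [|K s [d' d'0 IH]]; first by exists 1.
    have [d2 d20 Kd] := hu K _ d0; exists (Num.min d' d2); first by rewrite lt_min d'0.
    move=> K' K's x y Px Py; rewrite lt_min => /andP[xy1 xy2].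
    by move: K's; rewrite inE => /predU1P[->|/IH]; [exact: Kd|exact].
  by move=> /(_ (enum_fset G)).
exists d' => // x y Px Py xy; apply: Gd => K => [|KG]; rewrite cfB.
  rewrite mulr_natl mulr2n; apply: le_trans (le_normcD _ _) _.
  by rewrite (normcN (cf (h y) K)); apply: lerD; exact: hM.
exact: Gu.
Qed.

Lemma ucont_in_cvg (P : set R) (X : normedModType R) (h : R -> X) x : ucont_in P h -> P x ->
  h y @[y --> within P (nbhs x)] --> h x.
Proof.
move=> hu Px; apply/cvgrPdist_le => e e0; have [d d0 hd] := hu _ e0.
rewrite near_withinE; have : \forall y \near x, ball x d y by exact: nbhsx_ballx.
by apply: filterS => y xy Py; exact: hd.
Qed.

End UniformContinuityH.

Section BochnerIntegral.
Context d (T : measurableType d) (R : realType) (X : normedModType R).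
Variables (mu : {measure set T -> \bar R}) (D : set T) (v : R).
Hypotheses (mD : measurable D) (Dv : mu D = v%:E).

(** Monotonicity without measurability, read off the definition as a supremum over simple functions:
    the norm of an arbitrary vector-valued function is not known to be measurable. *)
Lemma le_integral_ge0 (f g : T -> \bar R) :
  (forall x, D x -> 0 <= f x)%E -> (forall x, D x -> f x <= g x)%E ->
  (\int[mu]_(x in D) f x <= \int[mu]_(x in D) g x)%E.
Proof.
move=> f0 fg; have g0 x : D x -> (0 <= g x)%E by move=> Dx; exact: le_trans (f0 x Dx) (fg x Dx).
rewrite !ge0_integralE//; apply: le_ereal_sup => _ [h /= hf <-]; exists h => // x.
apply: le_trans (hf x) _; rewrite !patchE; case: ifP => // /set_mem; exact: fg.
Qed.

Variable phi : X -> R.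
Hypothesis philin : forall (a : R) x y, phi (a *: x + y) = a * phi x + phi y.

Let phi0 : phi 0 = 0.
Proof. by have := philin (-1) 0 0; rewrite scaler0 addr0 mulN1r addNr. Qed.

Let phi_sum (I : Type) (r : seq I) (a : I -> R) (x : I -> X) :
  phi (\sum_(i <- r) a i *: x i) = \sum_(i <- r) a i * phi (x i).
Proof.
elim: r => [|i r IH]; first by rewrite !big_nil.
by rewrite !big_cons philin IH.
Qed.

Lemma simple_integral (s : T -> X) : bochner_simple mu D s ->
  mu.-integrable D (EFin \o (phi \o s)) /\
  phi (bochner_sintegral mu D s) = \int[mu]_(x in D) phi (s x).
Proof.
move=> [fs ms _]; pose r := fset_set (range s).
have mint x : mu.-integrable D (fun t => (\1_(s @^-1` [set x]) t)%:E).
  apply/integrableP; split; first exact/measurable_EFinP/measurable_funTS.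
  apply: (@le_lt_trans _ _ (\int[mu]_(t in D) (cst 1%:E t))%E); last first.
    by rewrite integral_cst// mul1e Dv ltry.
  apply: le_integral_ge0 => t _; first exact: abse_ge0.
  by rewrite indicE abse_EFin lee_fin; case: (_ \in _); rewrite ?normr1// normr0.
have sumE (q : seq X) :
    mu.-integrable D (EFin \o (fun t => \sum_(x <- q) phi x * \1_(s @^-1` [set x]) t)) /\
    \sum_(x <- q) fine (mu (D `&` s @^-1` [set x])) * phi x =
    \int[mu]_(t in D) \sum_(x <- q) phi x * \1_(s @^-1` [set x]) t.
  elim: q => [|x q [IH1 IH2]].
    rewrite big_nil; under [X in EFin \o X]eq_fun do rewrite big_nil.
    under eq_Rintegral do rewrite big_nil.
    by split; [exact: integrable0|rewrite /Rintegral integral0].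
  have pint : mu.-integrable D (EFin \o (fun t => phi x * \1_(s @^-1` [set x]) t)).
    by have := integrableZl mD (phi x) (mint x); apply: eq_integrable => // t _; rewrite /= EFinM.
  split.
    have := integrableD mD pint IH1; congr (integrable _ _ _).
    by apply/funext => t /=; rewrite big_cons EFinD.
  rewrite big_cons IH2; under [RHS]eq_Rintegral do rewrite big_cons.
  rewrite (RintegralD mD pint IH1); congr (_ + _).
  rewrite (RintegralZl _ mD (mint x)) mulrC; congr (_ * _).
  by rewrite /Rintegral integral_indic// setIC.
have phisE t : phi (s t) = \sum_(x <- r) phi x * \1_(s @^-1` [set x]) t.
  have tr : s t \in (r : seq X) by rewrite in_fset_set// inE; exists t.
  rewrite (bigD1_seq (s t))//= ?fset_uniq// big1 ?addr0.
    by rewrite indicE mem_set// mulr1.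
  move=> z /eqP xs; rewrite indicE memNset ?mulr0//= => sz; apply: xs.
  by rewrite sz.
have [i1 i2] := sumE r; split.
  by move: i1; congr (integrable _ _ _); apply/funext => t /=; rewrite phisE.
rewrite /bochner_sintegral (fsbigTE r); last first.
  move=> x; rewrite in_fset_set// => /negP xr; rewrite (_ : D `&` _ = set0).
    by rewrite measure0 scale0r.
  apply/seteqP; split => // t [_ /= st]; apply: xr; rewrite inE; exists t => //.
rewrite phi_sum i2; apply: eq_Rintegral => t _; by rewrite phisE.
Qed.

Hypothesis phi_le : forall x, `|phi x| <= `|x|.

(** Both the integral of [f - s n] and the distance of the simple integrals to [I] bound the effect
    on [phi]. As [I] is any value that the definition admits, this is the source of uniqueness. *)
Lemma bochner_integral_functional (f : T -> X) (I : X) (F : T -> R) :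
  has_bochner_integral mu D f I -> mu.-integrable D (EFin \o F) ->
  (forall t, D t -> phi (f t) = F t) -> phi I = \int[mu]_(t in D) F t.
Proof.
move=> [s [ss _ sf sI]] Fi fF; apply/eqP; rewrite -subr_eq0 -normr_le0.
apply/ler_addgt0Pr => e e0; rewrite add0r.
have e2 : 0 < e / 2 by rewrite divr_gt0.
have phiB x y : phi (x - y) = phi x - phi y.
  by rewrite -scaleN1r addrC philin mulN1r addrC.
near \oo => n.
have [si sE] := simple_integral (ss n).
have -> : phi I - \int[mu]_(t in D) F t =
    phi (I - bochner_sintegral mu D (s n)) + (\int[mu]_(t in D) (phi (s n t) - F t)).
  by rewrite phiB sE RintegralB//; lra.
rewrite [e]splitr; apply: le_trans (ler_normD _ _) _; apply: lerD.
  apply: le_trans (phi_le _) _; near: n.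
  by move/cvgrPdist_le: sI => /(_ _ e2).
have dI : mu.-integrable D (EFin \o (fun t => phi (s n t) - F t)).
  by have := integrableB mD si Fi; congr (integrable _ _ _).
apply: le_trans (le_normr_Rintegral mD dI) _.
have small : (\int[mu]_(t in D) `|f t - s n t|%:E < (e / 2)%:E)%E.
  near: n; have : nbhs (0 : \bar R)%E [set y | (y < (e / 2)%:E)%E].
    by apply: open_nbhs_nbhs; split; [exact: open_ereal_lt_ereal|rewrite /= lte_fin].
  by move=> /sf.
have ndI : (\int[mu]_(t in D) `|phi (s n t) - F t|%:E <= (e / 2)%:E)%E.
  apply: le_trans (ltW small); apply: le_integral_ge0 => t Dt; rewrite ?lee_fin//.

  by rewrite -fF// distrC -phiB phi_le.
rewrite -[leRHS]/(fine (e / 2)%:E) /Rintegral fine_le//.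
rewrite ge0_fin_numE ?(le_lt_trans ndI) ?ltry//.
by apply: integral_ge0 => t _; rewrite lee_fin.
Unshelve. all: by end_near. Qed.

End BochnerIntegral.

Section BochnerHper.
Variables (R : realType) (L ell : R) (C : {posnum R}).
Hypotheses (L0 : 0 < L) (hC : Hconst_admissible L ell C).
Local Notation H := (Hper L ell C).
Local Notation mu := (@lebesgue_measure R).
Variable t : R.
Hypothesis t0 : 0 <= t.
Local Notation D := (`[0, t]%classic : set (measurableTypeR R)).

Let mD : measurable D. Proof. exact: measurable_itv. Qed.
Let Dt : mu D = t%:E. Proof. exact: measure_seg0. Qed.

Lemma cf_norm_le (x : H) K : normc (cf x K) <= `|x|.
Proof. by apply: absum_term; exact: cf_absum. Qed.

Let re K (x : H) := complex.Re (cf x K).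
Let im K (x : H) := complex.Im (cf x K).

Let re_lin K (a : R) x y : re K (a *: x + y) = a * re K x + re K y.
Proof.
by rewrite /re cfD cfZ; case: (cf x K) (cf y K) => p q [p' q'] /=; rewrite mul0r subr0.
Qed.

Let im_lin K (a : R) x y : im K (a *: x + y) = a * im K x + im K y.
Proof.
by rewrite /im cfD cfZ; case: (cf x K) (cf y K) => p q [p' q'] /=; rewrite mul0r addr0.
Qed.

Let re_le K x : `|re K x| <= `|x|.
Proof. exact: le_trans (normc_Re _) (cf_norm_le _ _). Qed.

Let im_le K x : `|im K x| <= `|x|.
Proof. exact: le_trans (normc_Im _) (cf_norm_le _ _). Qed.

Lemma cf_sintegral (s : R -> H) K : bochner_simple mu D s ->
  cintegrable D (fun r => cf (s r) K) /\
  cf (bochner_sintegral mu D s) K = cintegral D (fun r => cf (s r) K).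
Proof.
move=> ss; have [i1 e1] := simple_integral mD Dt (@re_lin K) ss.
have [i2 e2] := simple_integral mD Dt (@im_lin K) ss.
split; first by split.
by apply/eqP; rewrite eq_complex; apply/andP; split; apply/eqP; [exact: e1|exact: e2].
Qed.

Lemma cf_bochner (f : R -> H) (I : H) (F : R -> R[i]) K :
  has_bochner_integral mu D f I -> cintegrable D F ->
  (forall r, 0 <= r <= t -> cf (f r) K = F r) -> cf I K = cintegral D F.
Proof.
move=> fI [F1 F2] fF; apply/eqP; rewrite eq_complex; apply/andP; split; apply/eqP.
- apply: (bochner_integral_functional mD Dt (@re_lin K) (@re_le K) fI F1) => r.
  by rewrite /= in_itv/= => /fF; rewrite /re => ->.
- apply: (bochner_integral_functional mD Dt (@im_lin K) (@im_le K) fI F2) => r.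
  by rewrite /= in_itv/= => /fF; rewrite /im => ->.
Qed.

(** Sampling at the left ends of cells of length 1/(n+1): the sample point never exceeds r and so
    stays in the segment where [h] is controlled. *)
Definition step (h : R -> H) (n : nat) (r : R) : H :=
  if 0 <= r <= t then h ((Num.truncn (r * n.+1%:R))%:R / n.+1%:R) else 0.

Lemma truncn_step n (r : R) : 0 <= r ->
  0 <= ((Num.truncn (r * n.+1%:R))%:R : R) / n.+1%:R <= r /\
  `|r - (Num.truncn (r * n.+1%:R))%:R / n.+1%:R| <= n.+1%:R^-1.
Proof.
move=> r0; have n0 : 0 < n.+1%:R :> R by rewrite ltr0n.
have := @truncn_itv R (r * n.+1%:R); rewrite mulr_ge0// ?(ltW n0)//.
move=> /(_ isT) /andP[k1 k2]; set k := Num.truncn _ in k1 k2 *.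
have kr : k%:R / n.+1%:R <= r by rewrite ler_pdivrMr.
split; first by rewrite kr divr_ge0// ltW.
rewrite ger0_norm ?subr_ge0// lerBlDl -{2}[_^-1]mul1r -mulrDl ler_pdivlMr//.
by rewrite natr1 ltW.
Qed.

Let step_index (r : R) n : 0 <= r <= t ->
  (Num.truncn (r * n.+1%:R) < (Num.truncn (t * n.+1%:R)).+1)%N.
Proof. by move=> /andP[r0 rt]; rewrite ltnS le_truncn// ler_pM2r// ltr0n. Qed.

Lemma measurable_step h n x : measurable (step h n @^-1` [set x] : set (measurableTypeR R)).
Proof.
have n0 : 0 < n.+1%:R :> R by rewrite ltr0n.
pose N := (Num.truncn (t * n.+1%:R)).+1.
pose A := \bigcup_(k in [set k | (k < N)%N /\ h (k%:R / n.+1%:R) = x])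
  (`[k%:R / n.+1%:R, k.+1%:R / n.+1%:R[%classic : set (measurableTypeR R)).
have -> : step h n @^-1` [set x] = (D `&` A) `|` (~` D `&` [set _ | (0 : H) = x]).
  apply/seteqP; split => r /=; rewrite /step !in_itv/=.
  + case: ifP => [rt hx|rt hx]; last by right; split => //; rewrite rt.
    left; split => //; exists (Num.truncn (r * n.+1%:R)); first by split; [exact: step_index|].
    rewrite /= in_itv/= ler_pdivrMr// ltr_pdivlMr//; apply: truncn_itv.
    by rewrite mulr_ge0// ?(ltW n0)//; case/andP: rt.
  + move=> [[rt [k [_ kx]]]|[/negP/negbTE ->]]; last by [].
    rewrite /= in_itv/= rt ler_pdivrMr// ltr_pdivlMr// => kr; rewrite -kx.
    congr (h (_%:R / _)); apply/eqP; rewrite truncn_eq//.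
    by rewrite mulr_ge0// ?(ltW n0)//; case/andP: rt.
apply: measurableU; apply: measurableI => //.
+ apply: fin_bigcup_measurable => [|k _]; last exact: measurable_itv.
  by apply: sub_finite_set (finite_II N) => k [].
+ exact: measurableC.
+ have [x0|x0] := eqVneq (0 : H) x.
    by rewrite (_ : [set _ | _] = setT)//; apply/seteqP; split.
  rewrite (_ : [set _ | _] = set0)//; apply/seteqP; split => // r /= /eqP.
  by rewrite (negbTE x0).
Qed.

Lemma step_simple h n : bochner_simple mu D (step h n).
Proof.
split=> [|x|x _]; last 2 first.
- exact: measurable_step.
- apply: (@le_lt_trans _ _ (mu D)); last by rewrite Dt ltry.
  apply: le_measure; rewrite ?inE; [|exact: mD|exact: subIsetl].
  by apply: measurableI => //; exact: measurable_step.
apply: (sub_finite_set (B := (fun k => h (k%:R / n.+1%:R)) @`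
    `I_(Num.truncn (t * n.+1%:R)).+1 `|` [set 0])).
  move=> _ [r _ <-]; rewrite /step; case: ifP => [/step_index rN|_]; last by right.
  by left; exists (Num.truncn (r * n.+1%:R)) => //; exact: rN.
by rewrite finite_setU; split => //; apply: finite_image; exact: finite_II.
Qed.

Lemma step_approx h : ucont_in [set r | 0 <= r <= t] h -> forall e, 0 < e ->
  \forall n \near \oo, forall r, 0 <= r <= t -> `|h r - step h n r| <= e.
Proof.
move=> hu e e0; have [d d0 hd] := hu _ e0; near=> n => r rt.
have /andP[r0 rt'] := rt; rewrite /step rt.
have [/andP[q0 qr] rq] := truncn_step n r0.
apply: hd => //=; first by rewrite q0 (le_trans qr).
apply: le_lt_trans rq _; near: n; exact: near_infty_natSinv_lt (PosNum d0).
Unshelve. all: by end_near. Qed.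

(** The integrals of the step functions are compared with [W] coefficient by coefficient, and
    [dominated_Hnorm] turns this into convergence in norm. *)
Lemma bochner_exists (h : R -> H) (W : H) (M : int -> R) b :
  (forall r, 0 <= r <= t -> forall K, normc (cf (h r) K) <= M K) ->
  (forall K, 0 <= M K) -> (sobolev_sum ell (fun K => (M K)%:C) <= b%:E)%E ->
  ucont_in [set r | 0 <= r <= t] h ->
  (forall K, cintegrable D (fun r => cf (h r) K)) ->
  (forall K, cf W K = cintegral D (fun r => cf (h r) K)) ->
  has_bochner_integral mu D h W.
Proof.
move=> hM M0 Mb hu hI WI; exists (step h); split.
- by move=> n; exact: step_simple.
- apply: aeW => r; rewrite /= in_itv/= => rt; apply/cvgrPdist_le => e e0.
  have := step_approx hu e0; apply: filterS => n; exact.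
- apply/fine_cvgP; split.
    have := step_approx hu ltr01; apply: filterS => n hn.
    rewrite ge0_fin_numE; last by apply: integral_ge0 => r _; rewrite lee_fin.
    apply: (@le_lt_trans _ _ (\int[mu]_(r in D) cst 1%:E r)%E).
      by apply: le_integral_ge0 => r; rewrite /= in_itv/= lee_fin// => /hn.
    by rewrite integral_cst// mul1e (le_lt_trans (_ : _ <= t%:E)%E) ?ltry// -Dt.
  apply/cvgrPdist_le => e e0; have t1 : 0 < t + 1 by rewrite ltr_wpDl.
  have := step_approx hu (divr_gt0 e0 t1); apply: filterS => n hn.
  rewrite /= sub0r normrN ger0_norm; last first.
    by apply: fine_ge0; apply: integral_ge0 => r _; rewrite lee_fin.
  have le1 : (\int[mu]_(r in D) `|h r - step h n r|%:E <= (e / (t + 1) * t)%:E)%E.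
    apply: (@le_trans _ _ (\int[mu]_(r in D) cst (e / (t + 1))%:E r)%E).
      by apply: le_integral_ge0 => r; rewrite /= in_itv/= lee_fin// => /hn.
    by rewrite integral_cst// [leRHS]EFinM; apply: lee_wpmul2l;
      rewrite ?lee_fin ?divr_ge0 ?(ltW e0) ?(ltW t1)// -Dt.
  apply: (@le_trans _ _ (e / (t + 1) * t)).
    rewrite -[leRHS]/(fine (e / (t + 1) * t)%:E) fine_le// ge0_fin_numE.
      by apply: le_lt_trans le1 _; rewrite ltry.
    by apply: integral_ge0 => r _; rewrite lee_fin.
  by rewrite mulrAC -mulrA ler_piMr ?(ltW e0)// ler_pdivrMr// mul1r lerDl.
- apply/cvgrPdist_le => e e0.
  (* The majorant 4 t M is the factor 2 t of [cintegral_bound] times M + M, for [h] and its step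
     function. *)
  have M4 K : 0 <= 4 * t * M K by rewrite mulr_ge0// mulr_ge0.
  have [G [d [d0 Gd]]] := dominated_Hnorm L C M4 (sobolev_sum_scale (4 * t) Mb) e0.
  have t1 : 0 < 2 * t + 1 by rewrite ltr_wpDl// mulr_ge0.
  have := step_approx hu (divr_gt0 d0 t1); apply: filterS => n hn.
  have diffE K : cf (W - bochner_sintegral mu D (step h n)) K =
      cintegral D (fun r => cf (h r - step h n r) K).
    have [sI sE] := cf_sintegral K (step_simple h n).
    rewrite cfB WI sE -cintegralB//; congr (cintegral _ _); apply/funext => r.
    by rewrite cfB.
  have diffI K : cintegrable D (fun r => cf (h r - step h n r) K).
    have [sI _] := cf_sintegral K (step_simple h n).
    have -> : (fun r => cf (h r - step h n r) K) = fun r => cf (h r) K - cf (step h n r) K.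
      by apply/funext => r; rewrite cfB.
    exact: cintegrableB.
  apply: Gd => K => [|_]; rewrite diffE.
    rewrite (_ : 4 * t * M K = 2 * t * (M K + M K)); last by ring.
    apply: cintegral_bound => // r rt; rewrite cfB.
    apply: le_trans (le_normcD _ _) _; rewrite (normcN (cf (step _ _ _) _)).
    apply: lerD; first exact: hM.
    rewrite /step rt; apply: hM; have /andP[r0 rt'] := rt.
    by have [/andP[q0 qr] _] := truncn_step n r0; rewrite q0 (le_trans qr).
  apply: (@le_trans _ _ (2 * t * (d / (2 * t + 1)))).
    apply: cintegral_bound => // r rt; apply: le_trans (cf_norm_le _ _) _; exact: hn.
  by rewrite mulrCA ler_piMr ?(ltW d0)// ler_pdivrMr// mul1r lerDl.
Qed.

End BochnerHper.

(** * Powers of a series as sums over words *)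

Section MonomialSums.
Variable R : realType.
Implicit Types c : int -> R[i].

Lemma csums_conj (I : choiceType) (f : I -> R[i]) s : csums f s ->
  csums (fun i => (f i)^*) (s^*)%R.
Proof.
move=> fs e e0; have [F0 F0e] := fs e e0; exists F0 => F /F0e.
by rewrite -rmorph_sum -rmorphB normc_conj.
Qed.

(** Induction on the length, splitting off the first letter and using the product of two absolutely
    summable families. *)
Lemma word_sums c B z : absum c B -> csums c z -> forall a,
  absum (fun w : seq int => if size w == a then \prod_(x <- w) c x else 0) (B ^+ a) /\
  csums (fun w : seq int => if size w == a then \prod_(x <- w) c x else 0) (z ^+ a).
Proof.
move=> cB cz; elim=> [|a [IHB IHz]].
  have E : (fun w : seq int => if size w == 0 then \prod_(x <- w) c x else 0) =
      fun w => if w == [::] then 1 else 0.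
    by apply/funext => -[|x w] //=; rewrite big_nil.
  rewrite E !expr0; split.
    move=> F; apply: le_trans (ler_sum_supp (s := [:: [::]]) (fset_uniq F) _ _) _.
    - by move=> w; exact: normc_ge0.
    - by move=> w _; rewrite inE => /negbTE ->; rewrite ComplexField.Normc.normc0.
    - by rewrite big_seq1 eqxx ComplexField.Normc.normc1.
  exact: (csums_single (f := fun w : seq int => if w == [::] then 1 else 0 : R[i])
    (j := [::]) (fun w => ifN _ _)).
have consB := absum_prod cB IHB; rewrite !exprS.
split; last first.
  (* The default letter 0 for the empty word is harmless: that word does not have length a + 1, so
     its term is 0. *)
  apply: (csums_reindex (phi := fun w : seq int => (head 0 w, behead w))
    (psi := fun xw : int * seq int => xw.1 :: xw.2) consB _ _ (csums_prod cB IHB cz IHz)).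
  - by case=> [|x w] /=; rewrite ?eqxx// eqSS big_cons; case: ifP; rewrite ?eqxx.
  - by move=> [x w] /= _; rewrite eqSS big_cons; case: ifP; rewrite ?mulr0.
move=> F; pose F' := [fset (head 0 w, behead w) | w in [fset w in F | size w == a.+1]]%fset.
apply: le_trans (consB F').
rewrite big_imfset/=; last first.
  move=> [|x w] [|y w']; rewrite ?inE ?andbF//= => _ _ [-> ->]//.
rewrite (bigID (fun w : seq int => size w == a.+1))/= [X in _ + X]big1 ?addr0; last first.
  by move=> w /negbTE ->; rewrite ComplexField.Normc.normc0.
rewrite big_fset_condE/= !big_seq le_eqVlt; apply/orP; left; apply/eqP.
apply: eq_bigr => -[|x w]; rewrite !inE/= => /andP[_]//.
by rewrite eqSS big_cons => /eqP ->; rewrite eqxx.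
Qed.

Lemma monomial_sums c B z ab : absum c B -> csums c z ->
  absum (fun i => if wsize i == ab then monomial c i else 0) (B ^+ ab.1 * B ^+ ab.2) /\
  csums (fun i => if wsize i == ab then monomial c i else 0)
    (z ^+ ab.1 * z^* ^+ ab.2).
Proof.
move=> cB cz; have cB' : absum (fun K => (c K)^*) B.
  by apply: absum_le cB _ => K; rewrite normc_conj.
have E : (fun i => if wsize i == ab then monomial c i else 0) = fun i : windex =>
    (if size i.1 == ab.1 then \prod_(x <- i.1) c x else 0) *
    (if size i.2 == ab.2 then \prod_(x <- i.2) (c x)^* else 0).
  apply/funext => -[j k]; case: ab => a b; rewrite /wsize xpair_eqE/=.
  by case: eqP => _; case: eqP => _; rewrite ?mulr0 ?mul0r.
have [a1 s1] := word_sums cB cz ab.1.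
have [a2 s2] := word_sums cB' (csums_conj cz) ab.2.
by rewrite E; split; [exact: (absum_prod a1 a2)|exact: (csums_prod a1 a2 s1 s2)].
Qed.

Lemma big_codom (S : Type) (idx : S) (op : Monoid.com_law idx) n
    (j : {ffun 'I_n -> int}) (F : int -> S) :
  \big[op/idx]_(x <- codom j) F x = \big[op/idx]_m F (j m).
Proof. by rewrite big_image/=; apply: eq_bigl => m. Qed.

(** Passes from words to the tuples of the resonant sets. [codom] lists the values of a tuple;
    reading a word by [nth] inverts it on words of the right length, and elsewhere the family
    vanishes. *)
Lemma csums_ffun (a b : nat) (P : windex -> bool) (f : windex -> R[i])
    (D : set ({ffun 'I_a -> int} * {ffun 'I_b -> int})) B s :
  absum (fun i => if (wsize i == (a, b)) && P i then f i else 0) B ->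
  csums (fun i => if (wsize i == (a, b)) && P i then f i else 0) s ->
  (forall jk, D jk <-> P (codom jk.1, codom jk.2)) ->
  has_csum D (fun jk => f (codom jk.1, codom jk.2)) s.
Proof.
move=> fB fs DP; apply/has_csumP.
pose psi (i : windex) : {ffun 'I_a -> int} * {ffun 'I_b -> int} :=
  ([ffun m : 'I_a => nth 0 i.1 m], [ffun m : 'I_b => nth 0 i.2 m]).
have codomK n (j : {ffun 'I_n -> int}) : [ffun m : 'I_n => nth 0 (codom j) m] = j.
  apply/ffunP => m; rewrite ffunE /codom (nth_map m) ?size_enum_ord//.
  by rewrite nth_ord_enum.
have nthK n (w : seq int) : size w = n -> codom [ffun m : 'I_n => nth 0 w m] = w.
  move=> wn; apply: (@eq_from_nth _ 0); first by rewrite size_codom card_ord.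
  move=> k; rewrite size_codom card_ord => kn.
  rewrite /codom (nth_map (Ordinal kn)) ?size_enum_ord// ffunE.
  by rewrite (_ : nth _ _ k = Ordinal kn)//; exact: (nth_ord_enum _ (Ordinal kn)).
pose phi (jk : {ffun 'I_a -> int} * {ffun 'I_b -> int}) : windex := (codom jk.1, codom jk.2).
apply: (csums_reindex (psi := psi) (phi := phi) fB _ _ fs).
- move=> [j k]; rewrite /patch; case: ifPn => [/set_mem /DP /= Pjk _|_]; last by rewrite eqxx.
  by rewrite /psi /phi /= !codomK /wsize /= !size_codom !card_ord eqxx Pjk.
- move=> [j k]; case: ifPn => [/andP[/eqP [ja kb] Pjk] _|_]; last by rewrite eqxx.
  rewrite /psi /phi /= !nthK//; split => //; rewrite /patch mem_set/=; first by rewrite !nthK.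
  by apply/DP; rewrite /= !nthK.
Qed.

End MonomialSums.

(** * The free flow on Fourier coefficients *)

Section Schrodinger.
Variables (R : realType) (L ell : R) (C : {posnum R}).
Hypotheses (L0 : 0 < L) (hC : Hconst_admissible L ell C).
Local Notation H := (Hper L ell C).

Definition phase (t : R) (K : int) : R[i] := expi (- t * (2 * pi * K%:~R / L) ^+ 2).

Lemma phaseE t K : phase t K = expi (- (2 * pi * K%:~R / L) ^+ 2 * t).
Proof. by rewrite /phase mulrC mulrN mulNr. Qed.

Lemma normc_phase t K : normc (phase t K) = 1. Proof. exact: normc_expi. Qed.

Lemma phaseD s t K : phase (s + t) K = phase s K * phase t K.
Proof. by rewrite /phase -expiD -mulrDl opprD. Qed.

Lemma monomial_phase t i :
  monomial (phase t) i = expi (- (2 * pi / L) ^+ 2 * (wquad i)%:~R * t).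
Proof.
rewrite monomial_expi; congr expi.
have E (r : seq int) : \sum_(x <- r) (- t * (2 * pi * x%:~R / L) ^+ 2) =
    - (2 * pi / L) ^+ 2 * (\sum_(x <- r) x ^+ 2)%:~R * t.
  rewrite rmorph_sum/= mulr_sumr mulr_suml; apply: eq_bigr => x _.
  rewrite rmorphXn/=; field; exact: lt0r_neq0.
by rewrite !E /wquad rmorphB/= mulrBr mulrBl.
Qed.

Lemma fseriesE (y : H) (c : int -> R[i]) : (forall K, cf y K = c K) -> fseries L c = y.
Proof.
move=> yc; apply/funext => t; apply: has_csumE; apply/has_csumTP.
by have := Hper_csums y t; under eq_fun do rewrite yc.
Qed.

Lemma sobolev_sum_mono (c : int -> R[i]) (M : int -> R) b :
  (forall K, normc (c K) <= M K) ->
  (sobolev_sum ell (fun K => (M K)%:C) <= b%:E)%E -> (sobolev_sum ell c <= b%:E)%E.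
Proof.
move=> cM /sobolev_sum_le Mb; apply/sobolev_sum_le => F; apply: le_trans (Mb F).
apply: ler_sum => K _; rewrite ler_wpM2l ?wt_ge0//.
have M0 : 0 <= M K := le_trans (normc_ge0 _) (cM K).
by rewrite normc_real ger0_norm// ler_sqr ?nnegrE ?normc_ge0.
Qed.

Lemma ex_dominated (c : int -> R[i]) (M : int -> R) b : 0 <= b ->
  (forall K, normc (c K) <= M K) ->
  (sobolev_sum ell (fun K => (M K)%:C) <= (b ^+ 2)%:E)%E ->
  exists y : H, forall K, cf y K = c K.
Proof.
by move=> b0 cM /(sobolev_sum_mono cM) cb; exact: (ex_Hper_sobolev L0 hC b0 cb).
Qed.

Lemma sobolev_sum_cf_normc (x : H) :
  (sobolev_sum ell (fun K => (normc (cf x K))%:C) <= ((`|x| / C%:num) ^+ 2)%:E)%E.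
Proof.
apply/sobolev_sum_le => F; apply: le_trans (Hnorm_ge x F); apply: ler_sum => K _.
by rewrite normc_real ger0_norm ?normc_ge0.
Qed.

Lemma ex_schrod t (x : H) : exists y : H, forall K, cf y K = phase t K * cf x K.
Proof.
apply: (@ex_dominated _ (fun K => normc (cf x K)) (`|x| / C%:num)).
- exact: divr_ge0.
- by move=> K; rewrite ComplexField.Normc.normcM normc_phase mul1r.
- exact: sobolev_sum_cf_normc.
Qed.

Definition schrod t (x : H) : H := projT1 (cid (ex_schrod t x)).

Lemma cf_schrod t x K : cf (schrod t x) K = phase t K * cf x K.
Proof. by rewrite /schrod; case: cid => y /= ->. Qed.

Lemma schrodE t x : schrod t x = schrodinger L t x :> (R -> R[i]).
Proof. by rewrite -(fseriesE (cf_schrod t x)). Qed.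

End Schrodinger.

(** * The Duhamel integral and the resonant average *)

Section ResonantAverage.
Variables (R : realType) (L ell : R) (C : {posnum R}).
Hypotheses (L0 : 0 < L) (hC : Hconst_admissible L ell C).
Local Notation H := (Hper L ell C).
Local Notation mu := (@lebesgue_measure R).
Local Notation tauP := (tauP L).
Local Notation phase := (phase L).
Local Notation schrod := (schrod L0 hC).
Variables (alpha : nat -> nat -> R[i]) (u : H) (A : R).
Hypothesis alphaA : forall B : seq (nat * nat), uniq B ->
  (forall ab, ab \in B -> (2 <= ab.1 + ab.2)%N) ->
  \sum_(ab <- B) normc (alpha ab.1 ab.2) * `|u| ^+ (ab.1 + ab.2) <= A.
Local Notation T := (wterm alpha u).
Let om : R := (2 * pi / L) ^+ 2.

Lemma tauP_gt0 : 0 < tauP.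
Proof. by rewrite divr_gt0 ?exprn_gt0// mulr_gt0// pi_gt0. Qed.

Lemma om_tauP : om = 2 * pi / tauP.
Proof.
have p0 : (pi : R) != 0 by rewrite lt0r_neq0// pi_gt0.
rewrite /om /Defs.tauP; move: (pi : R) p0 => p p0.
by field; rewrite p0 lt0r_neq0.
Qed.

Let B0 : {B : R | absum T B} := exist _ _ (wterm_absum L0 hC alphaA).

Let TB : absum T (projT1 B0). Proof. exact: projT2 B0. Qed.

Let Mex := cid (ex_majorant L0 hC alphaA).
Let M : int -> R := projT1 Mex.

Let MT K (F : {fset windex}) :
  \sum_(i <- F) (if wfreq i == K then normc (T i) else 0) <= M K.
Proof. by have [+ _] := projT2 Mex; apply. Qed.

Let M0 K : 0 <= M K.
Proof. by have := MT K fset0; rewrite big_seq_fset0. Qed.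

Let M_sobolev : exists2 b : R, 0 <= b &
  (sobolev_sum ell (fun K => (M K)%:C) <= (b ^+ 2)%:E)%E.
Proof.
have [_ Mb] := projT2 Mex; eexists; last exact: Mb.
by rewrite divr_ge0//; exact: absum_ge0 (wterm_absum L0 hC alphaA).
Qed.

Definition fterm K i : R[i] := if wfreq i == K then T i else 0.

Let fterm_absum K : absum (fterm K) (M K).
Proof.
move=> F; apply: le_trans (MT K F); apply: ler_sum => i _; rewrite /fterm.
by case: ifP => // _; rewrite ComplexField.Normc.normc0.
Qed.

Definition osc (s : R) (i : windex) : R[i] := expi (- om * (wquad i)%:~R * s).

Let osc1 s i : normc (osc s i) <= 1. Proof. by rewrite normc_expi. Qed.

(** The expected coefficient of rho(v(s)), defined by its sum over words; [rhoHE] identifies it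
    later. *)
Definition rho_coef (s : R) (K : int) : R[i] :=
  projT1 (cid (absum_csums (absumM (fterm_absum K) (osc1 s)))).

Lemma rho_coef_csums s K : csums (fun i => fterm K i * osc s i) (rho_coef s K).
Proof. by rewrite /rho_coef; case: cid. Qed.

Lemma rho_coef_le s K : normc (rho_coef s K) <= M K.
Proof. apply: csums_norm_le (rho_coef_csums s K) _; exact: absumM. Qed.

Let ex_rhoH s : exists y : H, forall K, cf y K = rho_coef s K.
Proof.
have [b b0 Mb] := M_sobolev; exact: ex_dominated b0 (rho_coef_le s) Mb.
Qed.

Definition rhoH s : H := projT1 (cid (ex_rhoH s)).

Lemma cf_rhoH s K : cf (rhoH s) K = rho_coef s K.
Proof. by rewrite /rhoH; case: cid => y /= ->. Qed.

Section Composition.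
Variables (Rad : \bar R) (rho : R[i] -> R[i]).
Hypothesis hseries : forall z : R[i], ((normc z)%:E < Rad)%E ->
  has_csum nonlin_index
    (fun ab => alpha ab.1 ab.2 * z ^+ ab.1 * z^* ^+ ab.2) (rho z).
Hypothesis hu : (`|u|%:E < Rad)%E.

(** At a fixed point x both sides are sums of the same family [F] over words, grouped by frequency
    on the left and by lengths on the right. *)
Lemma rhoHE s : rhoH s = rho \o schrod s u :> (R -> R[i]).
Proof.
apply/funext => x /=; apply: csums_unique (Hper_csums (rhoH s) x) _.
pose c K := cf (schrod s u) K * mode L K x; set z := schrod s u x.
have cB : absum c `|u|.
  apply: absum_le (cf_absum L0 hC u) _ => K.
  by rewrite /c cf_schrod !ComplexField.Normc.normcM normc_phase normc_mode mul1r mulr1 lexx.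
have cz : csums c z by exact: Hper_csums.
(* The coefficients of v(s) have the moduli of those of u, so the l^1 bound by the norm of u also
   bounds the value z. *)
have zR : ((normc z)%:E < Rad)%E.
  by apply: le_lt_trans hu; rewrite lee_fin; exact: csums_norm_le cz cB.
have cE : c = fun K => cf u K * (phase s K * mode L K x).
  by apply/funext => K; rewrite /c cf_schrod mulrA [cf u K * _]mulrC.
have monoE i : monomial c i = monomial (cf u) i * (osc s i * mode L (wfreq i) x).
  rewrite cE (monomialM (cf u)) (monomialM (phase s)) (monomial_phase L0).
  by rewrite [X in _ * (_ * X)](monomial_mode L x).
pose F i := T i * (osc s i * mode L (wfreq i) x).
have FB : absum F (projT1 B0).
  apply: absumM => // i.
  by rewrite ComplexField.Normc.normcM normc_expi normc_mode mulr1 lexx.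
have FE i : F i = wcoef alpha i * monomial c i by rewrite /F /wterm -mulrA monoE.
(* The fibre over lengths (a, b) sums to the corresponding term of the power series at z; for a + b
   < 2 it vanishes because [wcoef] does. *)
have Fz : csums F (rho z).
  have /has_csumP gz := hseries zR.
  apply: (csums_total FB (k := wsize) _ gz) => -[a b].
  have [_ ab] := monomial_sums (a, b) cB cz.
  rewrite /patch; case: ifPn => [/set_mem|/negP] /= ab2.
    have := csumsZ (alpha a b) ab; rewrite /= mulrA; congr csums; apply/funext => i.
    rewrite FE; case: eqP => [[ia ib]|_]; last by rewrite mulr0.
    by have ab2' : (2 <= a + b)%N := ab2; rewrite /wcoef ia ib ab2'.
  rewrite (_ : (fun i => _) = fun=> 0); first exact: csums0.
  apply/funext => i; rewrite FE; case: eqP => // -[ia ib]; rewrite /wcoef ia ib.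
  by case: ifP => [ab2'|_]; [case: ab2; rewrite inE|rewrite mul0r].
apply: (csums_fiber (k := wfreq) FB _ Fz) => K.
have := csumsZ (mode L K x) (rho_coef_csums s K); rewrite cf_rhoH mulrC; congr csums.
apply/funext => i; rewrite /fterm /F; case: eqP => [->|_]; first by rewrite mulrC -mulrA.
by rewrite mul0r mulr0.
Qed.

End Composition.

Definition duhamel (t s : R) : H := schrod (t - s) (rhoH s).

Definition dosc (t : R) K (s : R) (i : windex) : R[i] := phase (t - s) K * osc s i.

Lemma cf_duhamel t s K : cf (duhamel t s) K = phase (t - s) K * rho_coef s K.
Proof. by rewrite cf_schrod cf_rhoH. Qed.

Lemma duhamel_csums t s K : csums (fun i => fterm K i * dosc t K s i) (cf (duhamel t s) K).
Proof.
rewrite cf_duhamel; have := csumsZ (phase (t - s) K) (rho_coef_csums s K).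
by congr csums; apply/funext => i; rewrite /dosc mulrCA.
Qed.

Lemma dosc_le1 t K s i : normc (dosc t K s i) <= 1.
Proof. by rewrite ComplexField.Normc.normcM normc_phase mul1r osc1. Qed.

(** The dependence on s is a pure exponential, constant exactly when [wquad i] = K^2. *)
Lemma doscE t K s i : dosc t K s i = phase t K * expi (om * (K ^+ 2 - wquad i)%:~R * s).
Proof.
have E : (K ^+ 2 - wquad i)%:~R = K%:~R ^+ 2 - (wquad i)%:~R :> R.
  by rewrite rmorphB rmorphXn.
rewrite /dosc /osc -!expiD E; congr expi; rewrite /om.
move: (pi : R) => p; by field; exact: lt0r_neq0.
Qed.

Lemma ucont_dosc t K i : ucont (dosc t K ^~ i).
Proof.
rewrite (_ : (fun s => _) = fun s => phase t K * expi (om * (K ^+ 2 - wquad i)%:~R * s)).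
  by apply: ucontZ; exact: ucont_expi.
by apply/funext => s; exact: doscE.
Qed.

Lemma ucont_duhamel t K : ucont (fun s => cf (duhamel t s) K).
Proof.
exact: (ucont_series (phi := dosc t K) (fterm_absum K) (fun s i => dosc_le1 t K s i)
  (ucont_dosc t K) (fun s => duhamel_csums t s K)).
Qed.

Lemma duhamel_le t s K : normc (cf (duhamel t s) K) <= M K.
Proof.
by rewrite cf_duhamel ComplexField.Normc.normcM normc_phase mul1r; exact: rho_coef_le.
Qed.

Definition sol_coef t K : R[i] := cintegral `[0, t] (fun s => cf (duhamel t s) K).

Lemma sol_coef_le t K : 0 <= t -> normc (sol_coef t K) <= 2 * t * M K.
Proof.
move=> t0; apply: cintegral_bound => // [|s _]; last exact: duhamel_le.
exact: ucont_integrable (ucont_duhamel t K).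
Qed.

Let ex_sol t : exists y : H, 0 <= t -> forall K, cf y K = sol_coef t K.
Proof.
have [t0|t0] := leP 0 t; last by exists 0.
have [b b0 /(sobolev_sum_scale (2 * t)) Mb] := M_sobolev; rewrite -exprMn in Mb.
have t2b : 0 <= 2 * t * b by rewrite !mulr_ge0.
have [y yE] := ex_dominated L0 hC t2b (fun K => sol_coef_le K t0) Mb.
by exists y.
Qed.

Definition sol t : H := projT1 (cid (ex_sol t)).

Lemma cf_sol t K : 0 <= t -> cf (sol t) K = sol_coef t K.
Proof. by rewrite /sol; case: cid => y /= yE /yE. Qed.

Lemma ucont_in_duhamel t (P : set R) : ucont_in P (duhamel t).
Proof.
have [b _ Mb] := M_sobolev.
apply: ucont_in_Hper Mb M0 _ => [s _ K|K e e0]; first exact: duhamel_le.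
have [d d0 dd] := ucont_duhamel t K e0; exists d => // x y _ _; exact: dd.
Qed.

Lemma sol_bochner t : 0 <= t -> has_bochner_integral mu `[0, t] (duhamel t) (sol t).
Proof.
move=> t0; have [b _ Mb] := M_sobolev.
apply: (bochner_exists L0 hC t0 _ M0 Mb (@ucont_in_duhamel t _)) => [s _ K|K|K].
- exact: duhamel_le.
- exact: ucont_integrable (ucont_duhamel t K).
- exact: cf_sol.
Qed.

Lemma ucont_phase (K : int) : ucont (phase ^~ K).
Proof.
rewrite (_ : (fun t => _) = fun t => expi (- (2 * pi * K%:~R / L) ^+ 2 * t)).
  exact: ucont_expi.
by apply/funext => t; exact: phaseE.
Qed.

Lemma ucont_in_schrod (P : set R) : ucont_in P (schrod ^~ u).
Proof.
apply: (ucont_in_Hper (M := fun K => normc (cf u K)) _ (sobolev_sum_cf_normc u)).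
- by move=> s _ K; rewrite cf_schrod ComplexField.Normc.normcM normc_phase mul1r lexx.
- by move=> K; exact: normc_ge0.
move=> K e e0; have [d d0 dd] := ucontZ (cf u K) (ucont_phase K) e0.
by exists d => // x y _ _ /dd; rewrite !cf_schrod ![phase _ _ * _]mulrC.
Qed.

(** The group law frees the integrand from t, leaving t only in a factor of modulus 1 and in the
    upper end. *)
Lemma sol_coefE t K : 0 <= t ->
  sol_coef t K = phase t K * cintegral `[0, t] (fun s => cf (duhamel 0 s) K).
Proof.
move=> t0; rewrite -cintegralZ; last exact: ucont_integrable (ucont_duhamel 0 K).
congr (cintegral _ _); apply/funext => s.
by rewrite !cf_duhamel mulrA -phaseD sub0r.
Qed.

(** Each coefficient is a phase times an integral that is Lipschitz in its upper end; the common
    majorant 2 tauP M then gives continuity in norm. *)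
Lemma ucont_in_sol : ucont_in [set t | 0 <= t <= tauP] sol.
Proof.
have [b _ /(sobolev_sum_scale (2 * tauP)) Mb] := M_sobolev.
have M20 K : 0 <= 2 * tauP * M K by rewrite mulr_ge0// mulr_ge0// ltW// tauP_gt0.
have tM t K : t <= tauP -> 2 * t * M K <= 2 * tauP * M K.
  by move=> tP; rewrite ler_wpM2r// ler_wpM2l.
apply: (ucont_in_Hper _ Mb M20) => [t /= /andP[t0 tP] K|K e e0].
  by rewrite cf_sol//; apply: le_trans (sol_coef_le K t0) (tM _ _ tP).
pose I t := cintegral `[0, t] (fun s => cf (duhamel 0 s) K).
have Iu := ucont_duhamel 0 K.
have IM t : 0 <= t <= tauP -> normc (I t) <= 2 * tauP * M K.
  move=> /andP[t0 tP]; apply: le_trans (tM _ _ tP).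
  by apply: cintegral_bound (ucont_integrable t Iu) _ => // s _; exact: duhamel_le.
have IB x y : 0 <= x <= tauP -> 0 <= y <= tauP -> normc (I x - I y) <= 2 * M K * `|x - y|.
  wlog yx : x y / y <= x.
    move=> hw xP yP; have [/hw|/ltW/hw] := leP y x; first exact.
    by rewrite distrC normc_distC; exact.
  move=> /andP[_ xP] /andP[y0 _]; rewrite ger0_norm ?subr_ge0//.
  rewrite [leRHS](_ : _ = 2 * (x - y) * M K); last by ring.
  apply: cintegral_itvB => //; last by rewrite y0.
  by move=> s; exact: duhamel_le.
have e2 : 0 < e / 2 by rewrite divr_gt0.
have c1 : 0 < 2 * tauP * M K + 1 by rewrite ltr_wpDl.
have c2 : 0 < 2 * M K + 1 by rewrite ltr_wpDl// mulr_ge0.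
have [d d0 dd] := ucont_phase K (divr_gt0 e2 c1).
exists (Num.min d (e / 2 / (2 * M K + 1))); first by rewrite lt_min d0 divr_gt0.
move=> x y xP yP; rewrite lt_min => /andP[xyd xye].
have [x0 y0] : 0 <= x /\ 0 <= y by case/andP: xP; case/andP: yP.
rewrite !cf_sol// !sol_coefE// -/(I x) -/(I y).
have -> : phase x K * I x - phase y K * I y =
    (phase x K - phase y K) * I x + phase y K * (I x - I y) by ring.
rewrite [leRHS]splitr; apply: le_trans (le_normcD _ _) _; apply: lerD.
  rewrite ComplexField.Normc.normcM.
  apply: (@le_trans _ _ (e / 2 / (2 * tauP * M K + 1) * (2 * tauP * M K + 1))).
    apply: ler_pM; rewrite ?normc_ge0//; first exact: dd.
    by apply: le_trans (IM _ xP) _; rewrite lerDl.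
  by rewrite divfK// gt_eqF.
rewrite ComplexField.Normc.normcM normc_phase mul1r; apply: le_trans (IB _ _ xP yP) _.
apply: (@le_trans _ _ ((2 * M K + 1) * (e / 2 / (2 * M K + 1)))).
  by apply: ler_pM; rewrite ?mulr_ge0// ?lerDl// ltW.
by rewrite mulrC divfK// gt_eqF.
Qed.

Lemma phase_tauP K : phase tauP K = 1.
Proof.
rewrite /phase (_ : - tauP * _ = 2 * pi * (- K ^+ 2)%:~R) ?expi_2pi//.
have E : (- K ^+ 2)%:~R = - K%:~R ^+ 2 :> R by rewrite rmorphN rmorphXn.
have p0 : (pi : R) != 0 by rewrite lt0r_neq0// pi_gt0.
rewrite E /Defs.tauP; move: (pi : R) p0 => p p0.
by field; rewrite p0 lt0r_neq0.
Qed.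

Definition resonant_word (K : int) (i : windex) : bool :=
  (wfreq i == K) && (wquad i == K ^+ 2).

(** At tauP the outer phase is 1, and integrating an exponential of period tauP leaves tauP for a
    resonant word and 0 otherwise. *)
Lemma sol_resonant K :
  csums (fun i => if resonant_word K i then T i else 0)
    (tauP^-1%:C * sol_coef tauP K).
Proof.
have P0 := tauP_gt0.
have := cintegral_series (t := tauP) (ltW P0) (fterm_absum K)
  (fun s i => dosc_le1 tauP K s i) (ucont_dosc tauP K) (fun s => duhamel_csums tauP s K).
move=> /(csumsZ (tauP^-1%:C)); congr csums; apply/funext => i.
rewrite (_ : (fun s => _) =
    fun s => expi (2 * pi * (K ^+ 2 - wquad i)%:~R / tauP * s)); last first.
  by apply/funext => s; rewrite doscE phase_tauP mul1r om_tauP [2 * pi / _ * _]mulrAC.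
rewrite (cintegral_expi P0) subr_eq0 [K ^+ 2 == _]eq_sym /fterm /resonant_word.
case: (wfreq i == K); rewrite ?mul0r ?mulr0//=.
case: ifP => _; rewrite ?mulr0//.
by rewrite mulrCA -rmorphM mulVf ?gt_eqF// rmorph1 mulr1.
Qed.

Lemma resonant_coefE K : resonant_coef L alpha u K = tauP^-1%:C * sol_coef tauP K.
Proof.
apply: has_csumE; apply/has_csumP.
have TrB : absum (fun i => if resonant_word K i then T i else 0) (projT1 B0).
  apply: absum_le TB _ => i; case: ifP => // _.
  by rewrite ComplexField.Normc.normc0 normc_ge0.
apply: (csums_fiber (k := wsize) TrB _ (sol_resonant K)) => -[a b].
have uB := cf_absum L0 hC u; have [z uz] := absum_csums uB.
have [mB _] := monomial_sums (a, b) uB uz.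
have mrB : absum (fun i => if (wsize i == (a, b)) && resonant_word K i
    then monomial (cf u) i else 0) (`|u| ^+ a * `|u| ^+ b).
  apply: absum_le mB _ => i; case: (_ == _) => //=; case: ifP => // _.
  by rewrite ComplexField.Normc.normc0 normc_ge0.
(* [csum] is a limit, so a value is produced first; absolute summability of the monomials of lengths
   (a, b) provides it. *)
have [s rs] := absum_csums mrB.
have rP (jk : {ffun 'I_a -> int} * {ffun 'I_b -> int}) :
    resonant_set K jk <-> resonant_word K (codom jk.1, codom jk.2).
  rewrite /resonant_word /wfreq /wquad /= !big_codom.
  split=> [[q2 q1]|/andP[/eqP q1 /eqP q2]]; last by split; exact/esym.
  by apply/andP; split; apply/eqP; exact/esym.
have := csums_ffun mrB rs rP.
move=> rsE; rewrite /patch; case: ifPn => [/set_mem ab2|/negP ab2].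
  rewrite (has_csumE (s := s)) /=; last first.
    move: rsE; congr has_csum; apply/funext => jk.
    by rewrite /monomial !big_codom.
  have := csumsZ (alpha a b) rs; congr csums; apply/funext => i.
  have ab2' : (2 <= a + b)%N := ab2.
  case: eqP => [[ia ib]|_] /=; last by rewrite mulr0.
  by case: ifP => _; rewrite ?mulr0// /wterm /wcoef ia ib ab2'.
rewrite (_ : (fun i => _) = fun=> 0); first exact: csums0.
apply/funext => i; case: eqP => // -[ia ib]; case: ifP => // _.
rewrite /wterm /wcoef ia ib; case: ifP => [ab2'|_]; last by rewrite mul0r.
by case: ab2; rewrite inE.
Qed.

Lemma resonantE : resonant L alpha u = (tauP^-1 *: sol tauP : H) :> (R -> R[i]).
Proof.
apply: fseriesE => K; rewrite cfZ cf_sol ?resonant_coefE//.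
exact: ltW tauP_gt0.
Qed.

End ResonantAverage.

(** * Existence, uniqueness and the resonant formula *)

Lemma summable_bound (R : realType) (D : set (nat * nat)) (f : nat * nat -> R) :
  (forall ab, 0 <= f ab) -> (\esum_(ab in D) (f ab)%:E < +oo)%E ->
  exists A : R, forall B : seq (nat * nat), uniq B -> (forall ab, ab \in B -> D ab) ->
    \sum_(ab <- B) f ab <= A.
Proof.
move=> f0 fD; exists (fine (\esum_(ab in D) (f ab)%:E)) => B uB BD.
rewrite -lee_fin fineK ?ge0_fin_numE ?esum_ge0//; last by move=> ab _; rewrite lee_fin.
apply: esum_ge; exists [set` B]; first by split; [exact: finite_seq|move=> ab /BD].
by rewrite -fsbig_seq// sumEFin.
Qed.

Theorem theorem2p3 (R : realType) (L ell : R) (C : {posnum R})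
    (Rad : \bar R) (rho : R[i] -> R[i]) (alpha : nat -> nat -> R[i])
    (hL : 0 < L) (hell : 1 / 2 < ell)
    (hC : Hconst_admissible L ell C)
    (hRad : (0 < Rad)%E)
    (hrho : real_analytic rho)
    (hseries : forall z : R[i], ((normc z)%:E < Rad)%E ->
       has_csum nonlin_index
         (fun ab => alpha ab.1 ab.2 * z ^+ ab.1 * z^* ^+ ab.2) (rho z))
    (hsummable : forall r : R, 0 <= r -> (r%:E < Rad)%E ->
       (\esum_(ab in nonlin_index)
          (normc (alpha ab.1 ab.2) * r ^+ (ab.1 + ab.2))%:E < +oo)%E)
    (u : Hper L ell C) (hu : (`|u|%:E < Rad)%E) :
  exists v w : R -> Hper L ell C,
    [/\ mild_solution rho u v w,
        forall v' w' : R -> Hper L ell C, mild_solution rho u v' w' ->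
          forall t, 0 <= t <= tauP L -> v' t = v t /\ w' t = w t &
        resonant L alpha u = ((tauP L)^-1 *: w (tauP L) : Hper L ell C)
          :> (R -> R[i])].
Proof.
have [A alphaA] : exists A : R, forall B : seq (nat * nat), uniq B ->
    (forall ab, ab \in B -> (2 <= ab.1 + ab.2)%N) ->
    \sum_(ab <- B) normc (alpha ab.1 ab.2) * `|u| ^+ (ab.1 + ab.2) <= A.
  apply: summable_bound (hsummable _ (normr_ge0 u) hu) => ab.
  by rewrite mulr_ge0 ?normc_ge0 ?exprn_ge0.
pose v t := schrod hL hC t u; pose w := sol hL hC alphaA.
have rhoE s := rhoHE hL hC alphaA hseries hu s.
have duhE t s : duhamel hL hC alphaA t s =
    schrodinger L (t - s) (rhoH hL hC alphaA s) :> (R -> R[i]) by exact: schrodE.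
exists v, w; split=> [|v' w' [_ v'E [g [gE wE]]] t tP|].
- split.
  + apply/subspace_continuousP => t; rewrite /= in_itv/= => tP.
    have vc := ucont_in_cvg (ucont_in_schrod hL hC u [set t | 0 <= t <= tauP L]) tP.
    exact: cvg_pair vc (ucont_in_cvg (ucont_in_sol hL hC alphaA) tP).
  + by move=> t _; exact: schrodE.
  + exists (rhoH hL hC alphaA); split=> [s _|t /andP[t0 _]]; first exact: rhoE.
    exists (duhamel hL hC alphaA t); split=> [s _|]; first exact: duhE.
    exact: sol_bochner.
(* For uniqueness, v' is prescribed pointwise; this fixes rho(v') and the Duhamel integrand, hence
   by [cf_bochner] every coefficient of w'. *)
- have vv s : 0 <= s <= tauP L -> v' s = v s.
    by move=> sP; apply: Happ_inj; rewrite v'E// schrodE.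
  split; first exact: vv.
  have /andP[t0 tT] := tP.
  have [h [hE hw]] := wE _ tP; apply: cf_inj => K; rewrite cf_sol// /sol_coef.
  apply: (cf_bochner hL hC t0 hw) => [|s st].
    exact: ucont_integrable (ucont_duhamel hL hC alphaA t K).
  have sP : 0 <= s <= tauP L by case/andP: st => -> /le_trans ->.
  congr (cf _ K); apply: Happ_inj; rewrite hE// duhE; congr (schrodinger L _ _).
  by rewrite gE// rhoE vv.
- exact: resonantE.
Qed.
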